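(* Let $\emptyset\ne I\subseteq[d]$ with $I=\{i_1<\cdots<i_k\}$, $k=|I|$, let $f\in C^k(\overline S)$, and let $\varphi\in L^\infty(S)$ be centered on $I$. Define the upper-anchored $I$-orthant primitive $$(U_I\varphi)(\omega):=\int_{\omega_{i_1}}^{b_{i_1}}\cdots\int_{\omega_{i_k}}^{b_{i_k}}\varphi(\omega_{-I},t_I)\,dt_{i_k}\cdots dt_{i_1}.$$ Then $U_I\varphi\in L^\infty(S)$ and $$\|U_I\varphi\|_{L^\infty(S)}\le 2^{-k}\Lambda_{\mathrm{mix}}^I(\varphi).$$ Moreover, $$\int_S\varphi(\omega)f(\omega)\,d\omega=\int_S(U_I\varphi)(\omega)\,\partial_If(\omega)\,d\omega.$$ Consequently, $$\left|\int_S\varphi(\omega)f(\omega)\,d\omega\right|\le 2^{-k}\Lambda_{\mathrm{mix}}^I(\varphi)\int_S|\partial_If(\omega)|\,d\omega.$$ No sign or normalization assumption is imposed on $f$.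
   Context: Let $d\ge 1$, $[d]=\{1,\dots,d\}$, and let $S=\prod_{i=1}^d[a_i,b_i]\subset\mathbb R^d$ be a box with $a_i<b_i$. For $I\subseteq[d]$ write $\omega_I=(\omega_i)_{i\in I}$, $\omega_{-I}=(\omega_j)_{j\notin I}$, $S_I=\prod_{i\in I}[a_i,b_i]$, $S_{-I}=\prod_{j\notin I}[a_j,b_j]$ (a singleton if $I=[d]$), and $-i$ for $-\{i\}$; $\varphi(\omega_{-I},t_I)$ means that the $I$-coordinates are $t_I$ and the others are $\omega_{-I}$. A function $\varphi\in L^1(S)$ is centered on $I$ if for every $i\in I$ one has $\int_{a_i}^{b_i}\varphi(\omega_{-i},t)\,dt=0$ for a.e. $\omega_{-i}\in S_{-i}$. The mixed envelope is $$\Lambda_{\mathrm{mix}}^I(\varphi)=\operatorname*{ess\,sup}_{\omega_{-I}\in S_{-I}}\int_{S_I}|\varphi(\omega_{-I},t_I)|\,dt_I,$$ which equals $\|\varphi\|_{L^1(S)}$ if $I=[d]$. For $I=\{i_1<\cdots<i_k\}$, $\partial_If=\partial_{i_1}\cdots\partial_{i_k}f$. $C^k(\overline S)$ denotes functions that are $C^k$ up to the boundary of $S$. *)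

(* Defs.v *)
From HB Require Import structures.
From mathcomp Require Import all_boot all_order all_algebra.
From mathcomp Require Import all_classical all_reals all_analysis ess_sup_inf.

Set Implicit Arguments.
Unset Strict Implicit.
Unset Printing Implicit Defensive.

Import Order.TTheory GRing.Theory Num.Theory.
Import numFieldNormedType.Exports.

Local Open Scope classical_set_scope.
Local Open Scope ring_scope.

(* R^n is 'rV[R]_n with the sigma-algebra generated by the coordinates,      *)
(* i.e. the Borel sigma-algebra.                                             *)
Definition rV_display : measure_display.
Proof. exact. Qed.

Section measurable_rV.
Variables (R : realType) (n : nat).

Definition rV_coord (i : 'I_n) (x : 'rV[R]_n) : measurableTypeR R := x 0 i.

Let rV_set0 : g_sigma_preimage rV_coord set0.
Proof. exact: sigma_algebra0. Qed.

Let rV_setC A : g_sigma_preimage rV_coord A -> g_sigma_preimage rV_coord (~` A).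
Proof. exact: sigma_algebraC. Qed.

Let rV_bigcup (F : (set 'rV[R]_n)^nat) :
  (forall i, g_sigma_preimage rV_coord (F i)) ->
  g_sigma_preimage rV_coord (\bigcup_i F i).
Proof. exact: sigma_algebra_bigcup. Qed.

HB.instance Definition _ := @isMeasurable.Build rV_display
  'rV[R]_n (g_sigma_preimage rV_coord) rV_set0 rV_setC rV_bigcup.

Lemma measurable_rV_coord i : measurable_fun [set: 'rV[R]_n] (rV_coord i).
Proof.
move=> _ Y mY; rewrite setTI; apply: sub_sigma_algebra => /=.
rewrite -bigcup_seq/=; exists i => /=; first by rewrite mem_index_enum.
by exists Y => //; rewrite setTI.
Qed.

Lemma measurable_fun_rVP d (T : measurableType d) (f : T -> 'rV[R]_n) :
  (forall i, measurable_fun [set: T] (rV_coord i \o f)) ->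
  measurable_fun [set: T] f.
Proof.
move=> mf; have H : g_sigma_preimage (fun i => rV_coord i \o f) `<=` measurable.
  apply: smallest_sub; first exact: sigma_algebra_measurable.
  rewrite -bigcup_seq; apply: bigcup_sub => i _ A [B mB <-].
  exact: mf.
move=> _ A mA; apply: H; rewrite g_sigma_preimage_comp.
by exists A.
Qed.

End measurable_rV.

Section box.
Variables (R : realType) (n : nat).
Implicit Types a b : 'rV[R]_n.

Definition box a b : set 'rV[R]_n := [set x | forall i, a 0 i <= x 0 i <= b 0 i].

Lemma measurable_box a b : measurable (box a b).
Proof.
rewrite (_ : box a b = \bigcap_(i in [set: 'I_n])
    (rV_coord i @^-1` `[a 0 i, b 0 i])); last first.
  apply/seteqP; split => x /= xab i; first by move=> _; rewrite /= in_itv; exact: xab.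
  by have := xab i Logic.I; rewrite /= in_itv.
apply: fin_bigcap_measurable => [|i _]; first exact: finite_finset.
rewrite -[X in measurable X]setTI.
by apply: measurable_rV_coord => //; exact: measurable_itv.
Qed.

End box.

(* Lebesgue measure on R^n: iterated product of one-dimensional Lebesgue     *)
(* measure, carried by (t, x) |-> (t, x_0, ..., x_(n-1)).                    *)
Section lebesgue_rV.
Variable R : realType.

Definition rV_cons n (p : measurableTypeR R * 'rV[R]_n) : 'rV[R]_n.+1 :=
  \row_i if unlift 0 i is Some j then p.2 0 j else p.1.

Definition rV_uncons n (x : 'rV[R]_n.+1) : measurableTypeR R * 'rV[R]_n :=
  (x 0 0, \row_j x 0 (lift 0 j)).

Lemma rV_consK n : cancel (@rV_cons n) (@rV_uncons n).
Proof.
move=> [t x]; rewrite /rV_cons /rV_uncons mxE unlift_none; congr pair.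
by apply/rowP => j; rewrite !mxE liftK.
Qed.

Lemma measurable_rV_cons n : measurable_fun setT (@rV_cons n).
Proof.
apply: measurable_fun_rVP => i; rewrite /comp /rV_coord /rV_cons.
under eq_fun do rewrite mxE.
case: unliftP => [j _|_]; last exact: measurable_fst.
apply: (@measurableT_comp _ _ _ _ _ _ (rV_coord j) _ snd) => //.
exact: measurable_rV_coord.
Qed.

Lemma measurable_rV_uncons n : measurable_fun setT (@rV_uncons n).
Proof.
apply: measurable_fun_pair; first exact: (@measurable_rV_coord _ _ 0).
apply: measurable_fun_rVP => i; rewrite /comp /rV_coord.
under eq_fun do rewrite mxE.
exact: (@measurable_rV_coord _ _ (lift 0 i)).
Qed.

HB.instance Definition _ n :=
  isMeasurableFun.Build _ _ _ _ (@rV_cons n) (@measurable_rV_cons n).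

Section step.
Variables (n : nat) (m : {sigma_finite_measure set 'rV[R]_n -> \bar R}).

Definition lebesgue_step : set 'rV[R]_n.+1 -> \bar R :=
  pushforward (@lebesgue_measure R \x m)%E (@rV_cons n).

Let lebesgue_step0 : lebesgue_step set0 = 0%E.
Proof. exact: measure0. Qed.

Let lebesgue_step_ge0 A : (0 <= lebesgue_step A)%E.
Proof. exact: measure_ge0. Qed.

Let lebesgue_step_sigma_additive : semi_sigma_additive lebesgue_step.
Proof. exact: measure_semi_sigma_additive. Qed.

HB.instance Definition _ := isMeasure.Build _ _ _ lebesgue_step
  lebesgue_step0 lebesgue_step_ge0 lebesgue_step_sigma_additive.

Let lebesgue_step_sigma_finite : sigma_finite setT lebesgue_step.
Proof.
have /sigma_finiteP[F [TF ndF Foo]] := sigma_finiteT (@lebesgue_measure R).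
have /sigma_finiteP[G [TG ndG Goo]] := sigma_finiteT m.
exists (fun k => @rV_uncons n @^-1` (F k `*` G k)).
  apply/esym; rewrite -subTset => x _.
  have [i _ Fi] : (\bigcup_i F i) (rV_uncons x).1 by rewrite -TF.
  have [j _ Gj] : (\bigcup_i G i) (rV_uncons x).2 by rewrite -TG.
  exists (maxn i j) => //; split.
    by move: Fi; exact/subsetPset/ndF/leq_maxl.
  by move: Gj; exact/subsetPset/ndG/leq_maxr.
move=> k; have [mF ?] := Foo k; have [mG ?] := Goo k; split.
  rewrite -[X in measurable X]setTI.
  by apply: measurable_rV_uncons => //; exact: measurableX.
rewrite /lebesgue_step /pushforward -comp_preimage.
rewrite (_ : _ \o _ = id); last by apply/funext => p /=; rewrite rV_consK.
by rewrite preimage_id product_measure1E// lte_mul_pinfty// ge0_fin_numE.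
Qed.

HB.instance Definition _ := Measure_isSigmaFinite.Build _ _ _
  lebesgue_step lebesgue_step_sigma_finite.

End step.

Fixpoint lebesgue_rV_rec n : {sigma_finite_measure set 'rV[R]_n -> \bar R} :=
  if n is n'.+1 then lebesgue_step (lebesgue_rV_rec n') else \d_(0 : 'rV[R]_0).

Definition lebesgue_rV n : set 'rV[R]_n -> \bar R := lebesgue_rV_rec n.

HB.instance Definition _ n := Measure.on (@lebesgue_rV n).
HB.instance Definition _ n := SigmaFiniteMeasure.on (@lebesgue_rV n).

Lemma lebesgue_rV_box n (a b : 'rV[R]_n) : (forall i, a 0 i <= b 0 i) ->
  lebesgue_rV (box a b) = (\prod_i (b 0 i - a 0 i))%:E.
Proof.
elim: n a b => [|n ih] a b ab.
  by rewrite big_ord0 /lebesgue_rV/= diracE mem_set// => -[].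
pose tl (x : 'rV[R]_n.+1) : 'rV[R]_n := \row_j x 0 (lift 0 j).
rewrite [LHS]/= /lebesgue_rV /= /lebesgue_step /pushforward.
rewrite (_ : _ @^-1` _ = `[a 0 0, b 0 0] `*` box (tl a) (tl b)); last first.
  apply/seteqP; split => -[t x] /=.
    move=> H; split => [|j]; first by have := H 0; rewrite mxE unlift_none in_itv.
    by have := H (lift 0 j); rewrite !mxE liftK.
  move=> [tab xab] i; rewrite mxE; case: unliftP => [j ->|->].
    by have := xab j; rewrite !mxE.
  by move: tab; rewrite in_itv.
rewrite product_measure1E//=; last exact: measurable_box.
rewrite [X in (_ * X)%E](ih (tl a) (tl b)); last by move=> j; rewrite !mxE.
rewrite lebesgue_measure_itv/= lte_fin big_ord_recl EFinM.
congr (_ * _)%E; last by under eq_bigr do rewrite !mxE.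
case: ltP => // ba; have /eqP -> : a 0 0 == b 0 0 by rewrite eq_le ab ba.
by rewrite subrr.
Qed.

End lebesgue_rV.
Arguments lebesgue_rV {R n}.

(* For J = {j_0 < ... < j_(m-1)}, R^J is 'rV[R]_#|J| and coordinate k of a   *)
(* point of R^J is its j_k-th coordinate.                                    *)
Section subfamilies.
Variables (R : realType) (d : nat).
Implicit Types (I J : {set 'I_d}) (x a b : 'rV[R]_d).

Definition subvec J x : 'rV[R]_#|J| := \row_k x 0 (enum_val k).

(* The point of R^d with I-coordinates t and remaining coordinates w.        *)
Definition glue I (w : 'rV[R]_#|(~: I)%SET|) (t : 'rV[R]_#|I|) : 'rV[R]_d :=
  \row_i (\sum_(k | enum_val k == i) t 0 k + \sum_(k | enum_val k == i) w 0 k).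

Definition setcoord (i : 'I_d) (t : R) x : 'rV[R]_d :=
  \row_j if j == i then t else x 0 j.

Lemma glue_subvec I x y :
  glue (subvec (~: I)%SET x) (subvec I y) =
  \row_i if i \in I then y 0 i else x 0 i.
Proof.
apply/rowP => i; rewrite !mxE.
have sub J z : \sum_(k < #|J| | enum_val k == i) (subvec J z) 0 k =
    if i \in J then z 0 i else 0.
  case: ifPn => iJ.
    rewrite (big_pred1 (enum_rank_in iJ i)) ?mxE ?enum_rankK_in// => k /=.
    apply/eqP/eqP => [ki|->]; last exact: enum_rankK_in.
    by rewrite -(enum_valK_in iJ k) ki.
  rewrite big_pred0// => k; apply/negbTE; apply: contra iJ => /eqP <-.
  exact: enum_valP.
by rewrite !sub finset.in_setC; case: ifP => _; rewrite ?addr0 ?add0r.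
Qed.

End subfamilies.

(* L^p(S) for S = box a b is Lfun (lebesgue_box a b) p: its elements are      *)
(* Borel functions on R^d, of which only the restriction to S matters.       *)
Definition lebesgue_box (R : realType) n (a b : 'rV[R]_n) :
    {measure set 'rV[R]_n -> \bar R} :=
  mrestr (@lebesgue_rV R n) (measurable_box a b).

Section statement_notions.
Variables (R : realType) (d : nat) (a b : 'rV[R]_d).
Implicit Types (I J : {set 'I_d}) (phi f : 'rV[R]_d -> R).

Definition sub_box J : set 'rV[R]_#|J| := box (subvec J a) (subvec J b).

Local Arguments sub_box J _ : clear implicits.

Definition centered_on I phi := forall i, i \in I ->
  {ae lebesgue_rV, forall w : 'rV[R]_#|[set~ i]%SET|,
    sub_box [set~ i]%SET w ->
    (\int[lebesgue_measure]_(t in `[a 0%R i, b 0%R i])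
      (phi (glue w (const_mx t)))%:E = 0)%E}.

Definition mix_envelope I phi : \bar R :=
  ess_sup (lebesgue_box (subvec (~: I)%SET a) (subvec (~: I)%SET b))
    (fun w => \int[lebesgue_rV]_(t in sub_box I) `|phi (glue w t)|%:E)%E.

(* One-dimensional integration over [x_i, b_i], composed along i_1 < ... < i_k *)
(* with i_k innermost.  Since each step only overwrites its own coordinate,  *)
(* the lower limit used for i_j is the original coordinate of the argument.  *)
Definition upper_primitive1 (i : 'I_d) phi : 'rV[R]_d -> R := fun x =>
  \int[lebesgue_measure]_(t in `[x 0 i, b 0 i]) phi (setcoord i t x).

Definition upper_primitive I phi : 'rV[R]_d -> R :=
  foldr upper_primitive1 phi (enum I).

Definition pderiv (s : seq 'I_d) f : 'rV[R]_d -> R :=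
  foldr (fun i g => 'D_(delta_mx 0 i) g) f s.

(* C^k up to the boundary of the closed set S: partial derivatives of order  *)
(* at most k exist in the interior and extend continuously to S.             *)
Definition Ck_upto_boundary (k : nat) (S : set 'rV[R]_d) f :=
  {within S, continuous f} /\
  forall s : seq 'I_d, (size s <= k)%N ->
    ((size s < k)%N -> forall x i, S° x ->
      derivable (pderiv s f) x (delta_mx 0 i)) /\
    exists2 g : 'rV[R]_d -> R,
      {within S, continuous g} & forall x, S° x -> g x = pderiv s f x.

(* The continuous extension to S of the derivative taken in the interior.    *)
Definition pderiv_closure (S : set 'rV[R]_d) (s : seq 'I_d) f : 'rV[R]_d -> R :=
  fun x => lim (pderiv s f y @[y --> within S° (nbhs x)]).

End statement_notions.

(* Main.v *)
Require Import Defs.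
From HB Require Import structures.
From mathcomp Require Import all_boot all_order all_algebra.
From mathcomp Require Import all_classical all_reals all_analysis.
From mathcomp Require Import ess_sup_inf measurable_realfun.
From mathcomp Require Import ring lra.

Set Implicit Arguments.
Unset Strict Implicit.
Unset Printing Implicit Defensive.

Import Order.TTheory GRing.Theory Num.Theory.
Import numFieldNormedType.Exports.

Local Open Scope classical_set_scope.
Local Open Scope ring_scope.

Local Notation glue := Defs.glue.

(** Consider one coordinate [i] and a function [phi] centered on [i].  On a line
    parallel to the [i]-th axis, [phi] has integral zero, so the integrals of
    [phi] on the two sides of a point are opposite, and the upper primitive
    [U_i phi] is bounded by half the [L^1] norm of [phi] on that line
    ([mean_zero_half_bound]).  For the same reason [U_i phi] vanishes at both
    ends of the line, and integrating by parts against [f] leaves no boundary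
    term ([Rintegral_by_parts], [box_by_parts]).

    The theorem iterates this over the coordinates of [I], innermost first.
    The iteration can go on because, by Fubini's theorem, integrating over
    coordinate [i] commutes with [U_j] for [j != i]: taking the primitive in one
    coordinate preserves centering in the others
    ([ae_centered_iter_primitive]).  Each step costs a factor 1/2 and moves one
    derivative onto [f], while the line integrals of [|phi|] accumulate into the
    integral over [S_I] whose essential supremum is the mixed envelope
    ([iter_primitive_le], [iter_by_parts], [iter_le_mix_envelope]).

    Three devices keep this argument elementary.
    - Fubini's theorem is used through [ge0_integral_setcoord], which
      averages over one coordinate of a point of [R^d].  Subvectors only occur
      where centering and the envelope, which are stated with them, are
      translated ([negligible_subvec], [iter_coord_eintegralE]).
    - [phi] is bounded and centered almost everywhere only.  It is replaced by a
      truncation that is bounded on all of [S]; nothing changes, since a null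
      set meets almost every line in a null set ([ae_setcoord]).
    - A function continuous on the box is extended to [R^d] by composition
      with the projection [clamp] onto the box, so that measurability and
      continuity along lines are global. *)

(** * Comparing measures on R^n *)

Lemma box_setI (R : realType) n (a b u v : 'rV[R]_n) :
  box a b `&` box u v =
  box (\row_i Num.max (a 0 i) (u 0 i)) (\row_i Num.min (b 0 i) (v 0 i)).
Proof.
apply/seteqP; split => x /=.
  move=> [xab xuv] i; rewrite !mxE ge_max le_min.
  by have /andP[-> ->] := xab i; have /andP[-> ->] := xuv i.
move=> H; split => i; have := H i; rewrite !mxE ge_max le_min;
  by move=> /andP[/andP[? ?] /andP[? ?]]; apply/andP.
Qed.

Lemma lebesgue_rV_boxE (R : realType) n (u v : 'rV[R]_n) :
  lebesgue_rV (box u v) = (\prod_i Num.max 0 (v 0 i - u 0 i))%:E.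
Proof.
have [uv|] := boolP [forall i, u 0 i <= v 0 i].
  rewrite lebesgue_rV_box; last exact/forallP.
  congr (_%:E); apply: eq_bigr => i _.
  by rewrite max_r// subr_ge0; exact: (forallP uv).
rewrite negb_forall => /existsP[i]; rewrite -ltNge => vui.
rewrite (bigD1 i)//= max_l ?subr_le0 ?ltW// mul0r.
rewrite (_ : box u v = set0) ?measure0//.
apply/seteqP; split => // x /(_ i) /andP[ux xv].
by have := le_lt_trans (le_trans ux xv) vui; rewrite ltxx.
Qed.

Definition boxes (R : realType) n : set (set 'rV[R]_n) :=
  [set box u v | u in setT & v in setT].

Lemma measurable_rV_boxes (R : realType) n :
  @measurable _ 'rV[R]_n = <<s @boxes R n >>.
Proof.
apply/seteqP; split => [A mA|]; last first.
  apply: smallest_sub; first exact: sigma_algebra_measurable.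
  by move=> _ [u _ [v _ <-]]; exact: measurable_box.
pose T : measurableType _ := g_sigma_algebraType (@boxes R n).
suff mid : measurable_fun [set: T] (id : T -> 'rV[R]_n).
  by rewrite -[A]preimage_id -[X in <<s _ >> X]setTI; exact: mid.
apply: measurable_fun_rVP => i.
apply: (measurability (@RGenCInfty.G R)).
  exact: RGenCInfty.measurableE.
move=> _ [_ [x ->] <-]; rewrite setTI.
pose lo (k : nat) : 'rV[R]_n := \row_j if j == i then x else - k%:R.
pose hi (k : nat) : 'rV[R]_n := const_mx k%:R.
(* The half-space is exhausted by boxes whose lower [i]-th face stays at [x]. *)
rewrite (_ : _ @^-1` _ = \bigcup_k box (lo k) (hi k)); last first.
  apply/seteqP; split => y /=; rewrite in_itv/= andbT.
    move=> xy; pose M := \sum_j `|y 0 j|.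
    have yM j : `|y 0 j| <= M.
      by rewrite /M (bigD1 j)//= lerDl sumr_ge0.
    exists (Num.truncn M).+1 => // j; rewrite !mxE.
    have /ltW MM : M < (Num.truncn M).+1%:R by exact: truncnS_gt.
    have := le_trans (yM j) MM; rewrite ler_norml => /andP[lb ->].
    by rewrite andbT; case: eqP => // ->.
  by move=> [k _ /(_ i)]; rewrite !mxE eqxx => /andP[].
apply: (@bigcupT_measurable _ T) => k.
by apply: sub_sigma_algebra; exists (lo k) => //; exists (hi k).
Qed.

(** Boxes form a generating pi-system, which is how measures on [R^n] are
    compared below. *)
Lemma rV_measure_unique (R : realType) n
    (m1 m2 : {measure set 'rV[R]_n -> \bar R}) :
  (forall u v, m1 (box u v) = m2 (box u v)) ->
  (forall u v, (m1 (box u v) < +oo)%E) ->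
  forall A, measurable A -> m1 A = m2 A.
Proof.
move=> m12 m1oo; pose N (k : nat) : 'rV[R]_n := const_mx k%:R.
apply: (@measure_unique _ _ _ (@boxes R n) (fun k => box (- N k) (N k))).
- exact: measurable_rV_boxes.
- move=> _ _ [u _ [v _ <-]] [u' _ [v' _ <-]]; rewrite box_setI.
  by eexists; [|eexists; [|reflexivity]].
- by move=> k; exists (- N k) => //; exists (N k).
- rewrite -subTset => y _; pose M := \sum_j `|y 0 j|.
  exists (Num.truncn M).+1 => // j; rewrite !mxE -ler_norml.
  apply: le_trans (ltW (truncnS_gt M)).
  by rewrite /M (bigD1 j)//= lerDl sumr_ge0.
- by move=> _ [u _ [v _ <-]].
- by move=> k.
Qed.

(** Splitting coordinates and changing one of them are maps into [R^n] defined
    on products; the images of product measures under them are identified by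
    the volumes of the preimages of boxes. *)
Lemma rV_pushforward_unique (R : realType) d (T : measurableType d) n
    (m : {measure set T -> \bar R}) (g : T -> 'rV[R]_n)
    (mg : measurable_fun setT g) (m2 : {measure set 'rV[R]_n -> \bar R}) :
  (forall u v, m (g @^-1` box u v) = m2 (box u v)) ->
  (forall u v, (m2 (box u v) < +oo)%E) ->
  forall A, measurable A -> m (g @^-1` A) = m2 A.
Proof.
move=> m12 m2oo A mA.
(* A pushforward is a measure only for a measurable map, hence the explicit
   structure built from [mg]. *)
apply: (@rV_measure_unique _ _
  (measure_function_pushforward__canonical__measure_function_Measure m mg))
  => //= u v.
by rewrite [X in (X < _)%E]m12.
Qed.

(** * Splitting the coordinates along a subset *)

Section glue.
Context (R : realType) (d : nat) (I : {set 'I_d}).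
Local Notation gl := (fun p : 'rV[R]_#|(~: I)%SET| * 'rV[R]_#|I| =>
  glue p.1 p.2 : 'rV[R]_d).

Lemma glue_enum_val (w : 'rV[R]_#|(~: I)%SET|) (t : 'rV[R]_#|I|) :
  (forall k, glue w t 0 (enum_val k) = t 0 k) /\
  (forall k, glue w t 0 (enum_val k) = w 0 k).
Proof.
split => k; rewrite mxE.
  rewrite (big_pred1 k) => [|j]; last by rewrite /= (inj_eq enum_val_inj).
  rewrite big_pred0 ?addr0// => j; apply/negbTE/eqP => jk.
  by have := enum_valP j; rewrite jk finset.in_setC enum_valP.
rewrite big_pred0 => [|j]; last first.
  apply/negbTE/eqP => jk.
  by have := enum_valP k; rewrite -jk finset.in_setC enum_valP.
rewrite (big_pred1 k) ?add0r// => j; by rewrite /= (inj_eq enum_val_inj).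
Qed.

Lemma enum_val_cases (i : 'I_d) :
  (exists k : 'I_#|I|, i = enum_val k) \/
  (exists k : 'I_#|(~: I)%SET|, i = enum_val k).
Proof.
have [iI|iI] := boolP (i \in I).
  by left; exists (enum_rank_in iI i); rewrite enum_rankK_in.
right; have iI' : i \in (~: I)%SET by rewrite finset.in_setC.
by exists (enum_rank_in iI' i); rewrite enum_rankK_in.
Qed.

Lemma subvec_glue (w : 'rV[R]_#|(~: I)%SET|) (t : 'rV[R]_#|I|) :
  subvec (~: I)%SET (glue w t) = w.
Proof. by apply/rowP => k; rewrite mxE (glue_enum_val w t).2. Qed.

Lemma preimage_glue_box (u v : 'rV[R]_d) :
  gl @^-1` box u v = box (subvec (~: I)%SET u) (subvec (~: I)%SET v) `*`
                     box (subvec I u) (subvec I v).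
Proof.
apply/seteqP; split => -[w t] /=.
  move=> H; split => k; have := H (enum_val k);
    by rewrite ?(glue_enum_val w t).1 ?(glue_enum_val w t).2 ![subvec _ _ _ _]mxE.
move=> [Hw Ht] i; have [[k ->]|[k ->]] := enum_val_cases i.
  by have := Ht k; rewrite (glue_enum_val w t).1 ![subvec _ _ _ _]mxE.
by have := Hw k; rewrite (glue_enum_val w t).2 ![subvec _ _ _ _]mxE.
Qed.

Lemma measurable_glue : measurable_fun setT gl.
Proof.
apply: measurable_fun_rVP => i; have [[k ->]|[k ->]] := enum_val_cases i.
  rewrite (_ : _ \o _ = rV_coord k \o snd); last first.
    by apply/funext => -[w t]; rewrite /= /rV_coord (glue_enum_val w t).1.
  by apply: measurableT_comp => //; exact: measurable_rV_coord.
rewrite (_ : _ \o _ = rV_coord k \o fst); last first.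
  by apply/funext => -[w t]; rewrite /= /rV_coord (glue_enum_val w t).2.
by apply: measurableT_comp => //; exact: measurable_rV_coord.
Qed.

(** [lebesgue_rV] peels off the first coordinate again and again, which does not
    follow the splitting of the coordinates along an arbitrary [I].  Volumes of
    boxes do. *)
Lemma lebesgue_rV_glue (A : set 'rV[R]_d) : measurable A ->
  (lebesgue_rV \x lebesgue_rV)%E (gl @^-1` A) = lebesgue_rV A.
Proof.
move=> mA; apply: (rV_pushforward_unique measurable_glue) => //.
  move=> u v; rewrite preimage_glue_box/= product_measure1E//;
    [|exact: measurable_box..].
  rewrite /= !lebesgue_rV_boxE -EFinM; congr (_%:E).
  rewrite [RHS](bigID (fun i => i \in (~: I)%SET))/=; congr (_ * _).
    by rewrite [RHS]big_enum_val; apply: eq_bigr => k _; rewrite !mxE.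
  rewrite [RHS](eq_bigl (fun i => i \in I)); last by move=> i; rewrite /= finset.in_setC negbK.
  by rewrite [RHS]big_enum_val; apply: eq_bigr => k _; rewrite !mxE.
by move=> u v; rewrite /= lebesgue_rV_boxE ltry.
Qed.

(** Statements on almost every [w_{-I}] thus hold at almost every point of
    [R^d]. *)
Lemma negligible_subvec (N : set 'rV[R]_#|(~: I)%SET|) :
  lebesgue_rV.-negligible N ->
  lebesgue_rV.-negligible (subvec (~: I)%SET @^-1` N : set 'rV[R]_d).
Proof.
move=> [B [mB B0 NB]]; have mB' : measurable (subvec (~: I)%SET @^-1` B : set 'rV[R]_d).
  rewrite -[X in measurable X]setTI.
  have : measurable_fun setT (fun x : 'rV[R]_d => subvec (~: I)%SET x).
    apply: measurable_fun_rVP => k.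
    rewrite (_ : _ \o _ = rV_coord (enum_val k)); first exact: measurable_rV_coord.
    by apply/funext => x; rewrite /= /rV_coord mxE.
  by apply.
exists (subvec (~: I)%SET @^-1` B); split.
- exact: mB'.
- rewrite -lebesgue_rV_glue// (_ : (fun _ => _) @^-1` _ = B `*` setT); last first.
    by apply/seteqP; split => -[w t] /=; rewrite subvec_glue// => -[].
  by rewrite product_measure1E// [X in (X * _)%E]B0 mul0e.
- by move=> x /NB.
Qed.
End glue.

(** * Integrals along one coordinate of R^d *)

Lemma ge0_integral_mrestr d (T : measurableType d) (R : realType)
    (m : {measure set T -> \bar R}) (D : set T) (mD : measurable D)
    (f : T -> \bar R) :
  measurable_fun setT f -> (forall x, (0 <= f x)%E) ->
  (\int[mrestr m mD]_x f x = \int[m]_(x in D) f x)%E.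
Proof.
move=> mf f0; rewrite [LHS](@ge0_negligible_integral _ _ _ _ _ (~` D))//;
  [|exact: measurableC|by rewrite /= /mrestr setICl measure0].
rewrite setDE setCK setTI; apply: eq_measure_integral => A mA AD.
by rewrite /= /mrestr (setIidl AD).
Qed.

Section setcoord.
Context (R : realType) (d : nat).
Implicit Types (i j : 'I_d) (x a b u v : 'rV[R]_d) (t : R).

Lemma setcoordE i t x j :
  setcoord i t x 0 j = if j == i then t else x 0 j.
Proof. by rewrite mxE. Qed.

Lemma setcoord_id i t x : setcoord i t x 0 i = t.
Proof. by rewrite mxE eqxx. Qed.

Lemma setcoord_setcoord i t s x : setcoord i t (setcoord i s x) = setcoord i t x.
Proof. by apply/rowP => j; rewrite !mxE; case: eqP. Qed.

Lemma setcoordC i j t s x : i != j ->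
  setcoord i t (setcoord j s x) = setcoord j s (setcoord i t x).
Proof.
move=> ij; apply/rowP => k; rewrite !mxE; have [->|//] := eqVneq k i.
by rewrite (negbTE ij).
Qed.

Lemma measurable_setcoord i :
  measurable_fun setT (fun p : 'rV[R]_d * measurableTypeR R => setcoord i p.2 p.1).
Proof.
apply: measurable_fun_rVP => j; rewrite /comp /rV_coord.
under eq_fun do rewrite setcoordE.
case: eqP => _; first exact: measurable_snd.
by apply: (measurableT_comp (measurable_rV_coord j)); exact: measurable_fst.
Qed.

Lemma measurable_setcoord1 i x : measurable_fun setT (fun t : measurableTypeR R => setcoord i t x).
Proof.
apply: measurable_fun_rVP => j; rewrite /comp /rV_coord.
under eq_fun do rewrite setcoordE.
by case: eqP => _; [exact: measurable_id|exact: measurable_cst].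
Qed.

Lemma measurable_setcoord2 i t : measurable_fun setT (fun x => setcoord i t x).
Proof.
apply: measurable_fun_rVP => j; rewrite /comp /rV_coord.
under eq_fun do rewrite setcoordE.
by case: eqP => _; [exact: measurable_cst|exact: measurable_rV_coord].
Qed.

Lemma box_setcoord a b i t x :
  box a b x -> a 0 i <= t <= b 0 i -> box a b (setcoord i t x).
Proof. by move=> xab tab j; rewrite setcoordE; case: eqP => [->|_]; [|exact: xab]. Qed.

Context (a b : 'rV[R]_d) (ab : forall i, a 0 i <= b 0 i).
Local Notation S := (box a b).
Local Notation itv i := (`[a 0 i, b 0 i]%classic : set (measurableTypeR R)).

(** Both sides are finite measures in [A], so that boxes suffice.  There the
    coordinate [x 0 i], overwritten by [t], ranges freely over the [i]-th side
    of [S], which contributes the factor [b 0 i - a 0 i]. *)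
Lemma setcoord_box_measure i A : measurable A ->
  (lebesgue_rV \x lebesgue_measure)%E
    ((fun p => setcoord i p.2 p.1) @^-1` A `&` (S `*` itv i)) =
  ((b 0 i - a 0 i)%:E * lebesgue_rV (A `&` S))%E.
Proof.
move=> mA; have mSi : measurable (S `*` itv i).
  by apply: measurableX => //; exact: measurable_box.
have c0 : 0 <= b 0 i - a 0 i by rewrite subr_ge0.
apply: (@rV_pushforward_unique _ _ _ _ (mrestr (lebesgue_rV \x lebesgue_measure)%E mSi)
  _ (measurable_setcoord i) (mscale (NngNum c0) (lebesgue_box a b)) _ _ A mA) => u v; last first.
  rewrite /= /mscale/= /lebesgue_box /mrestr box_setI lebesgue_rV_boxE -EFinM.
  exact: ltry.
rewrite /= /mscale/= /lebesgue_box /mrestr box_setI lebesgue_rV_boxE.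
set u' := \row__ Num.max _ _; set v' := \row__ Num.min _ _.
rewrite (_ : _ `&` _ = box (setcoord i (a 0 i) u') (setcoord i (b 0 i) v')
    `*` `[u' 0 i, v' 0 i]); last first.
  apply/seteqP; split => -[x t] /=.
    rewrite in_itv/= => -[xuv [xab tab]]; rewrite in_itv/=; split.
      move=> j; rewrite !setcoordE; case: eqP => [->//|ji].
      rewrite /u' /v' !mxE ge_max le_min.
      have /andP[-> ->] := xab j; have := xuv j; rewrite setcoordE.
      by case: eqP => // _ /andP[-> ->].
    have /andP[ta tb] := tab; have := xuv i; rewrite setcoord_id /u' /v' !mxE ge_max le_min.
    by move=> /andP[-> ->]; rewrite ta tb.
  rewrite in_itv/= => -[xuv]; rewrite /u' /v' !mxE ge_max le_min.
  move=> /andP[/andP[ut at']/andP[tv tb]].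
  rewrite in_itv/= at' tb; split; [|split] => //.
    move=> j; rewrite setcoordE; case: eqP => [->|ji]; first by rewrite ut tv.
    have := xuv j; rewrite !setcoordE; case: eqP => // _.
    by rewrite /u' /v' !mxE ge_max le_min => /andP[/andP[-> _]/andP[-> _]].
  move=> j; have := xuv j; rewrite !setcoordE; case: eqP => [->//|ji].
  by rewrite /u' /v' !mxE ge_max le_min => /andP[/andP[_ ->]/andP[_ ->]].
rewrite product_measure1E//; last exact: measurable_box.
rewrite /= lebesgue_rV_boxE lebesgue_measure_itv/= lte_fin -EFinM.
rewrite (bigD1 i)//= [in RHS](bigD1 i)//= !setcoord_id.
rewrite (_ : \prod_(j | j != i) _ = \prod_(j | j != i) Num.max 0 (v' 0 j - u' 0 j)); last first.
  by apply: eq_bigr => j /negbTE ji; rewrite !setcoordE ji.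
rewrite (max_r c0) (_ : (if _ then _ else _) = (Num.max 0 (v' 0 i - u' 0 i))%:E).
  by rewrite -!EFinM; congr (_%:E); ring.
case: ltP => h; first by rewrite -EFinB max_r// subr_ge0 ltW.
by rewrite max_l// subr_le0.
Qed.

(** Tonelli's theorem for the [i]-th coordinate, without splitting [R^d]: the
    left-hand side also integrates over the overwritten coordinate [x 0 i],
    whence the factor. *)
Lemma ge0_integral_setcoord i (F : 'rV[R]_d -> \bar R) :
  measurable_fun setT F -> (forall x, (0 <= F x)%E) ->
  (\int[lebesgue_rV]_(x in S) \int[lebesgue_measure]_(t in itv i) F (setcoord i t x) =
   (b 0 i - a 0 i)%:E * \int[lebesgue_rV]_(x in S) F x)%E.
Proof.
move=> mF F0.
have mS : measurable S by exact: measurable_box.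
have mSi : measurable (S `*` itv i) by exact: measurableX.
have c0 : 0 <= b 0 i - a 0 i by rewrite subr_ge0.
pose G (p : 'rV[R]_d * measurableTypeR R) := F (setcoord i p.2 p.1).
have mG : measurable_fun setT G by exact: measurableT_comp (measurable_setcoord i).
transitivity (\int[lebesgue_rV]_x \int[lebesgue_measure]_t ((G \_ (S `*` itv i)) (x, t)))%E.
  rewrite integral_mkcond; apply: eq_integral => x _; rewrite patchE.
  case: ifPn => xS.
    rewrite integral_mkcond; apply: eq_integral => t _; rewrite !patchE in_setX/= xS/=.
    by case: ifP.
  by rewrite integral0_eq// => t _; rewrite patchE in_setX/= (negbTE xS).
have -> : (\int[lebesgue_rV]_x \int[lebesgue_measure]_t ((G \_ (S `*` itv i)) (x, t)) =
   \int[(lebesgue_rV \x lebesgue_measure)%E]_(p in S `*` itv i) G p)%E.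
  rewrite [RHS]integral_mkcond [RHS]fubini_tonelli1//.
    by apply/(measurable_restrictT _ mSi); exact: measurable_funTS.
  by move=> p; rewrite patchE; case: ifP => // _; exact: F0.
transitivity (\int[mrestr (lebesgue_rV \x lebesgue_measure)%E mSi]_x G x)%E.
  by apply/esym; apply: (@ge0_integral_mrestr _ _ _ _ _ mSi _ mG) => p; exact: F0.
rewrite -(@ge0_integral_mrestr _ _ _ _ _ mS _ mF)//.
have PF := @ge0_integral_pushforward _ _ _ _ _ _ (measurable_setcoord i)
  (mrestr (lebesgue_rV \x lebesgue_measure)%E mSi) setT F measurableT mF (fun x _ => F0 x).
rewrite preimage_setT in PF; rewrite -[LHS]PF.
have MS := @ge0_integral_mscale _ _ _ (lebesgue_box a b) setT measurableT
  (NngNum c0) F mF (fun x _ => F0 x).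
rewrite -[RHS]MS.
apply: (@eq_measure_integral _ _ _ _ (mscale (NngNum c0) (lebesgue_box a b))
  (measure_function_pushforward__canonical__measure_function_Measure _
    (measurable_setcoord i))) => A mA _.
rewrite /= /mscale/= /pushforward/= /mrestr. exact: setcoord_box_measure.
Qed.

Lemma measurable_ge0_integral_setcoord i (F : 'rV[R]_d -> \bar R) :
  measurable_fun setT F -> (forall x, (0 <= F x)%E) ->
  measurable_fun setT
    (fun x => \int[lebesgue_measure]_(t in itv i) F (setcoord i t x))%E.
Proof.
move=> mF F0.
have mSi : measurable ([set: 'rV[R]_d] `*` itv i) by exact: measurableX.
pose G (p : 'rV[R]_d * measurableTypeR R) := F (setcoord i p.2 p.1).
have mG : measurable_fun setT (G \_ ([set: 'rV[R]_d] `*` itv i)).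
  apply/(measurable_restrictT _ mSi); apply: measurable_funTS.
  exact: measurableT_comp (measurable_setcoord i).
have G0 p : (0 <= (G \_ ([set: 'rV[R]_d] `*` itv i)) p)%E.
  by rewrite patchE; case: ifP => // _; exact: F0.
have := measurable_fun_fubini_tonelli_F (m2 := lebesgue_measure) _ mG G0.
congr (measurable_fun _ _); apply/funext => x; rewrite /fubini_F [RHS]integral_mkcond.
by apply: eq_integral => t _; rewrite !patchE in_setX/= in_setT.
Qed.

(** Apply the previous identity to the indicator of the exceptional set. *)
Lemma ae_setcoord i (P : 'rV[R]_d -> Prop) :
  (\forall x \ae lebesgue_rV, S x -> P x) ->
  \forall x \ae lebesgue_rV, S x ->
    \forall t \ae lebesgue_measure, t \in `[a 0 i, b 0 i] -> P (setcoord i t x).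
Proof.
move=> [N [mN N0 PN]]; have mS : measurable S by exact: measurable_box.
pose F x : \bar R := (\1_N x)%:E.
have mF : measurable_fun setT F.
  by apply/measurable_EFinP; exact: measurable_indic.
have F0 x : (0 <= F x)%E by rewrite lee_fin.
pose H x := (\int[lebesgue_measure]_(t in itv i) F (setcoord i t x))%E.
have mH : measurable_fun setT H by exact: measurable_ge0_integral_setcoord.
have H0 x : (0 <= H x)%E by apply: integral_ge0.
have : (\int[lebesgue_rV]_(x in S) `|H x| = 0)%E.
  under eq_integral do rewrite gee0_abs//.
  rewrite ge0_integral_setcoord// integral_indic// [X in (_ * X)%E](_ : _ = 0%E) ?mule0//.
  by apply: (subset_measure0 _ mN _ N0); [exact: measurableI|exact: subIsetl].
move=> /(ae_eq_integral_abs lebesgue_rV mS (measurable_funTS mH)).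
apply: filterS => x Hx Sx; have Hx0 := Hx Sx.
have mFx : measurable_fun (itv i) (fun t => F (setcoord i t x)).
  apply: measurable_funTS; apply: measurableT_comp mF _.
  exact: measurable_setcoord1.
have : (\int[lebesgue_measure]_(t in itv i) `|F (setcoord i t x)| = 0)%E.
  by under eq_integral do rewrite gee0_abs//.
have mi : measurable (itv i) by exact: measurable_itv.
move=> /(ae_eq_integral_abs lebesgue_measure mi mFx).
apply: filterS => t + tab; rewrite inE in tab => /(_ tab) Ft0.
have : ~ N (setcoord i t x).
  move=> Nt; move: Ft0; rewrite /F /= indicE mem_set// => -[/eqP].
  by rewrite oner_eq0.
move=> /(contra_not (PN _)) /= /contrapT; apply; exact: box_setcoord.
Qed.

End setcoord.

(** * Bounded functions on sets of finite measure *)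

Definition bounded_in (T : Type) (R : numDomainType) (D : set T) (f : T -> R) :=
  exists2 M, 0 <= M & forall x, D x -> `|f x| <= M.

Lemma bounded_inS (T : Type) (R : numDomainType) (D E : set T) (f : T -> R) :
  D `<=` E -> bounded_in E f -> bounded_in D f.
Proof. by move=> DE [M M0 fM]; exists M => // x /DE; exact: fM. Qed.

Lemma bounded_inM (T : Type) (R : numDomainType) (D : set T) (f g : T -> R) :
  bounded_in D f -> bounded_in D g -> bounded_in D (fun x => f x * g x).
Proof.
move=> [M M0 fM] [N N0 gN]; exists (M * N); first exact: mulr_ge0.
by move=> x Dx; rewrite normrM ler_pM// ?fM// gN.
Qed.

Lemma compact_bounded_in (T : topologicalType) (R : realType) (A : set T) (f : T -> R) :
  compact A -> {within A, continuous f} -> bounded_in A f.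
Proof.
move=> cA cf; have /compact_bounded [M [_ fM]] := continuous_compact cf cA.
exists (`|M| + 1) => [|x Ax]; first by rewrite addr_ge0.
by apply: (fM (`|M| + 1)); [rewrite (le_lt_trans (ler_norm M))// ltrDl|exists x].
Qed.

Section bounded_integrable.
Context d (T : measurableType d) (R : realType) (mu : {measure set T -> \bar R}).
Variables (D : set T) (mD : measurable D) (Doo : (mu D < +oo)%E).

Lemma bounded_in_integrable (f : T -> R) :
  measurable_fun D f -> bounded_in D f -> mu.-integrable D (EFin \o f).
Proof.
move=> mf [M M0 fM]; apply: measurable_bounded_integrable => //.
by exists M; split; [exact: num_real|move=> K /ltW MK x /fM /le_trans; exact].
Qed.

Lemma EFin_Rintegral (f : T -> R) :
  measurable_fun D f -> bounded_in D f ->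
  ((\int[mu]_(x in D) f x)%:E = \int[mu]_(x in D) (f x)%:E)%E.
Proof.
by move=> mf bf; rewrite fineK//; apply: integrable_fin_num => //; exact: bounded_in_integrable.
Qed.

Lemma le_normr_Rintegral_bounded (f : T -> R) M :
  measurable_fun D f -> (forall x, D x -> `|f x| <= M) ->
  `|\int[mu]_(x in D) f x| <= M * fine (mu D).
Proof.
move=> mf fM; have [D0|/set0P[x0 Dx0]] := eqVneq D set0.
  by rewrite D0 Rintegral_set0 measure0 mulr0 normr0.
have M0 : 0 <= M by exact: le_trans (normr_ge0 _) (fM _ Dx0).
have bf : bounded_in D f by exists M.
apply: le_trans (le_normr_Rintegral mD (bounded_in_integrable mf bf)) _.
rewrite -lee_fin EFin_Rintegral; last 2 first.
- exact: measurableT_comp.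
- by exists M => // x Dx; rewrite normr_id fM.
rewrite EFinM fineK ?ge0_fin_numE//.
have := @integral_le_bound _ _ _ mu D (EFin \o f) M%:E mD.
rewrite lee_fin; apply => //; first exact/measurable_EFinP.
by apply: aeW => x Dx /=; rewrite lee_fin fM.
Qed.

End bounded_integrable.

Section Rintegral_swap.
Context d1 d2 (T1 : measurableType d1) (T2 : measurableType d2) (R : realType).
Context (m1 : {sigma_finite_measure set T1 -> \bar R}).
Context (m2 : {sigma_finite_measure set T2 -> \bar R}).

Lemma Rintegral_swap (A : set T1) (B : set T2) (h : T1 * T2 -> R) :
  measurable A -> measurable B -> (m1 A < +oo)%E -> (m2 B < +oo)%E ->
  measurable_fun setT h -> bounded_in (A `*` B) h ->
  \int[m1]_(x in A) \int[m2]_(y in B) h (x, y) =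
  \int[m2]_(y in B) \int[m1]_(x in A) h (x, y).
Proof.
move=> mA mB Aoo Boo mh bh; have mAB : measurable (A `*` B) by exact: measurableX.
have ABoo : ((m1 \x m2)%E (A `*` B) < +oo)%E.
  by rewrite product_measure1E// lte_mul_pinfty// ge0_fin_numE.
have ih : (m1 \x m2)%E.-integrable setT ((EFin \o h) \_ (A `*` B)).
  apply/(integrable_mkcond _ mAB); apply: bounded_in_integrable => //.
  exact: measurable_funTS.
have [M M0 hM] := bh.
have L : (\int[m1]_x \int[m2]_y ((EFin \o h) \_ (A `*` B)) (x, y) =
    \int[m1]_(x in A) (\int[m2]_(y in B) h (x, y))%:E)%E.
  rewrite [RHS]integral_mkcond; apply: eq_integral => x _.
  rewrite [RHS]patchE; case: ifPn => xA; last first.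
    by rewrite integral0_eq// => y _; rewrite patchE in_setX/= (negbTE xA).
  rewrite EFin_Rintegral//.
  - rewrite [RHS]integral_mkcond; apply: eq_integral => y _.
    by rewrite !patchE in_setX/= xA.
  - by apply: measurable_funTS; exact: measurableT_comp mh (measurable_pair1 _).
  - by exists M => // y By; apply: hM; split => //=; rewrite inE in xA.
have L' : (\int[m2]_y \int[m1]_x ((EFin \o h) \_ (A `*` B)) (x, y) =
    \int[m2]_(y in B) (\int[m1]_(x in A) h (x, y))%:E)%E.
  rewrite [RHS]integral_mkcond; apply: eq_integral => y _.
  rewrite [RHS]patchE; case: ifPn => yB; last first.
    by rewrite integral0_eq// => x _; rewrite patchE in_setX/= (negbTE yB) andbF.
  rewrite EFin_Rintegral//.
  - rewrite [RHS]integral_mkcond; apply: eq_integral => x _.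
    by rewrite !patchE in_setX/= yB andbT.
  - by apply: measurable_funTS; exact: measurableT_comp mh (measurable_pair2 _).
  - by exists M => // x Ax; apply: hM; split => //=; rewrite inE in yB.
by rewrite /Rintegral -L -L' (Fubini ih).
Qed.
End Rintegral_swap.

(** * Mean-zero functions on an interval *)

Section one_dimensional.
Context (R : realType).
Implicit Types (p q u : R) (g : R -> R).
Local Notation mR := (measurableTypeR R).
Local Notation leb := (@lebesgue_measure R).

Lemma lebesgue_itv_lty p q : (leb `[p, q]%classic < +oo)%E.
Proof. by rewrite lebesgue_measure_itv/=; case: ifP => _; rewrite ?ltry// -EFinB ltry. Qed.

Lemma bounded_itv_integrable p q (g : R -> R) :
  measurable_fun (setT : set mR) g -> bounded_in `[p, q]%classic g ->
  leb.-integrable `[p, q]%classic (EFin \o g).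
Proof.
move=> mg bg; apply: bounded_in_integrable => //.
- exact: lebesgue_itv_lty.
- exact: measurable_funTS.
Qed.

(** The integrals on the two sides of [u] are opposite, so that each of them is
    bounded by the [L^1] norms on both sides. *)
Lemma mean_zero_half_bound p q u (g : R -> R) :
  measurable_fun (setT : set mR) g -> bounded_in `[p, q]%classic g ->
  p <= u <= q -> \int[leb]_(t in `[p, q]) g t = 0 ->
  `|\int[leb]_(t in `[u, q]) g t| <= 2^-1 * \int[leb]_(t in `[p, q]) `|g t|.
Proof.
move=> mg bg /andP[pu uq] g0.
have ig := bounded_itv_integrable mg bg.
have split_at (h : R -> R) : measurable_fun (setT : set mR) h -> bounded_in `[p, q]%classic h ->
    \int[leb]_(t in `[p, q]) h t =
    \int[leb]_(t in `[p, u]) h t + \int[leb]_(t in `[u, q]) h t.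
  move=> mh bh; apply/eqP; rewrite addrC -subr_eq; apply/eqP.
  rewrite Rintegral_itvB ?bnd_simp//; last exact: bounded_itv_integrable.
  apply: Rintegral_itv_obnd_cbnd.
  apply: (integrableS _ _ _ (bounded_itv_integrable mh bh)) => //.
  by apply: subset_itv; rewrite bnd_simp.
have mag : measurable_fun (setT : set mR) (fun t => `|g t|) by exact: measurableT_comp.
have bag : bounded_in `[p, q]%classic (fun t => `|g t|).
  by have [M M0 gM] := bg; exists M => // t tpq; rewrite normr_id gM.
rewrite (split_at _ mag bag); move: g0; rewrite (split_at _ mg bg) => g0.
have l1 : `|\int[leb]_(t in `[u, q]) g t| <= \int[leb]_(t in `[u, q]) `|g t|.
  apply: le_normr_Rintegral => //; apply: bounded_itv_integrable => //.
  apply: bounded_inS bg; by apply: subset_itv; rewrite bnd_simp.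
have l2 : `|\int[leb]_(t in `[u, q]) g t| <= \int[leb]_(t in `[p, u]) `|g t|.
  rewrite -(addr0_eq g0) normrN; apply: le_normr_Rintegral => //.
  apply: bounded_itv_integrable => //.
  apply: bounded_inS bg; by apply: subset_itv; rewrite bnd_simp.
by rewrite mulrC ler_pdivlMr// mulr_natr mulr2n lerD.
Qed.

(** Integration by parts against a primitive of a merely bounded [g], hence by
    Fubini on the triangle [s <= t] rather than by the product rule. *)
Lemma Rintegral_by_parts p q (g G h : R -> R) : p < q ->
  measurable_fun (setT : set mR) g -> bounded_in `[p, q]%classic g ->
  \int[leb]_(t in `[p, q]) g t = 0 ->
  {within `[p, q]%classic, continuous h} ->
  derivable_oo_LRcontinuous G p q ->
  {in `]p, q[, G^`()%classic =1 h} ->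
  \int[leb]_(t in `[p, q]) (g t * G t) =
  \int[leb]_(s in `[p, q]) ((\int[leb]_(t in `[s, q]) g t) * h s).
Proof.
move=> pq mg bg g0 ch dG Gh.
have mpq : measurable (`[p, q]%classic : set mR) by exact: measurable_itv.
have bh : bounded_in `[p, q]%classic h.
  exact: compact_bounded_in (@segment_compact _ _ _) ch.
have mh : measurable_fun (`[p, q]%classic : set mR) h.
  exact: subspace_continuous_measurable_fun.
pose h' : mR -> R := h \_ `[p, q]%classic.
have mh' : measurable_fun (setT : set mR) h'.
  exact: (measurable_restrictT (h : mR -> R) mpq).1 mh.
have h'E t : t \in `[p, q] -> h' t = h t.
  by move=> tpq; rewrite /h' patchE mem_set.
have cG := derivable_oo_LRcontinuous_within dG.
have mG : measurable_fun (`[p, q]%classic : set mR) G.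
  exact: subspace_continuous_measurable_fun.
have bG : bounded_in `[p, q]%classic G.
  exact: compact_bounded_in (@segment_compact _ _ _) cG.
have FTC t : t \in `[p, q] -> G t = G p + \int[leb]_(s in `[p, t]) h s.
  rewrite in_itv/= => /andP[pt tq].
  have [->|pt'] := eqVneq t p.
    by rewrite set_itv1 Rintegral_set1 addr0.
  have {}pt' : p < t by rewrite lt_def pt'.
  have sub : `[p, t]%classic `<=` `[p, q]%classic.
    by apply: subset_itv; rewrite bnd_simp.
  have := @continuous_FTC2 R h G p t pt'.
  rewrite -EFinB /Rintegral => ->.
  - by rewrite /= addrC subrK.
  - exact: continuous_subspaceW ch.
  - exact: derivable_oo_continuousW dG.
  - move=> u; rewrite in_itv/= => /andP[pu ut]; apply: Gh.
    by rewrite in_itv/= pu (lt_le_trans ut).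
pose K (z : mR * mR) : R := if z.2 <= z.1 then g z.1 * h' z.2 else 0.
have mK : measurable_fun setT K.
  apply: measurable_fun_ifT => //.
  - by apply: measurable_fun_ler; [exact: measurable_snd|exact: measurable_fst].
  - apply: measurable_funM; first exact: measurableT_comp mg measurable_fst.
    exact: measurableT_comp mh' measurable_snd.
have bK : bounded_in (`[p, q]%classic `*` `[p, q]%classic) K.
  have [M M0 gM] := bg; have [N N0 hN] := bh.
  exists (M * N); first exact: mulr_ge0.
  move=> [t s] [/= tpq spq]; rewrite /K/= h'E//; case: ifP => _.
    by rewrite normrM ler_pM// ?gM// hN.
  by rewrite normr0 mulr_ge0.
have := Rintegral_swap mpq mpq (lebesgue_itv_lty p q) (lebesgue_itv_lty p q) mK bK.
have -> : \int[leb]_(x in `[p, q]) \int[leb]_(y in `[p, q]) K (x, y) =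
    \int[leb]_(t in `[p, q]) (g t * G t).
  transitivity (\int[leb]_(t in `[p, q]) (g t * G t - G p * g t)); last first.
    rewrite RintegralB//; last 2 first.
    - apply: bounded_in_integrable => //; first exact: lebesgue_itv_lty.
        by apply: measurable_funM => //; exact: measurable_funTS.
      exact: bounded_inM.
    - apply: bounded_in_integrable => //; first exact: lebesgue_itv_lty.
        by apply: measurable_funM => //; exact: measurable_funTS.
      by apply: bounded_inM => //; exists `|G p|.
    rewrite RintegralZl// ?g0 ?mulr0 ?subr0//.
    exact: bounded_itv_integrable.
  apply: eq_Rintegral => t; rewrite inE/= => tpq.
  rewrite FTC// mulrDr [G p * _]mulrC addrAC subrr add0r.
  have /andP[pt tq] : p <= t <= q by move: tpq; rewrite in_itv.
  rewrite -RintegralZl//; last first.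
    have sub : `[p, t]%classic `<=` `[p, q]%classic.
      by apply: subset_itv; rewrite bnd_simp.
    apply: bounded_in_integrable => //; first exact: lebesgue_itv_lty.
      exact: (measurable_funS mpq sub).
    exact: bounded_inS bh.
  rewrite (_ : `[p, t]%classic = `[p, q]%classic `&` `]-oo, t]%classic); last first.
    apply/seteqP; split => u /=; rewrite !in_itv/=.
      by move=> /andP[pu ut]; rewrite pu ut (le_trans ut).
    by move=> [/andP[-> _] ->].
  rewrite Rintegral_mkcondr; apply: eq_Rintegral => s; rewrite inE/= => spq.
  by rewrite patchE /K/= mem_setE in_itv/= h'E.
move=> ->.
apply: eq_Rintegral => s; rewrite inE/= => spq.
have /andP[ps sq] : p <= s <= q by move: spq; rewrite in_itv.
rewrite mulrC -RintegralZl//; last first.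
  apply: bounded_itv_integrable => //; apply: bounded_inS bg.
  by apply: subset_itv; rewrite bnd_simp.
rewrite (_ : `[s, q]%classic = `[p, q]%classic `&` `[s, +oo[%classic); last first.
  apply/seteqP; split => u /=; rewrite !in_itv/= andbT.
    by move=> /andP[su uq]; rewrite su uq (le_trans ps).
  by move=> [/andP[_ ->] ->].
rewrite Rintegral_mkcondr; apply: eq_Rintegral => t; rewrite inE/= => tpq.
by rewrite patchE /K/= mem_setE in_itv/= andbT h'E// mulrC.
Qed.

End one_dimensional.

(** * Primitives and integrals in one coordinate *)

Section coordinate_integrals.
Context (R : realType) (d : nat) (a b : 'rV[R]_d) (ab : forall i, a 0 i < b 0 i).
Implicit Types (i j : 'I_d) (phi psi : 'rV[R]_d -> R).
Local Notation S := (box a b).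
Local Notation U := (upper_primitive1 b).
Local Notation mR := (measurableTypeR R).
Local Notation leb := (@lebesgue_measure R).
Local Notation measurable_rV := (measurable_fun (setT : set 'rV[R]_d)).

Definition coord_integral i phi x :=
  \int[leb]_(t in `[a 0 i, b 0 i]) phi (setcoord i t x).
Local Notation V := coord_integral.

(** Measurability and bounds for [coord_integral] are those of
    [upper_primitive1]. *)
Lemma coord_integralE i phi x : V i phi x = U i phi (setcoord i (a 0 i) x).
Proof.
rewrite /V /upper_primitive1 setcoord_id; apply: eq_Rintegral => t _.
by rewrite setcoord_setcoord.
Qed.

Lemma measurable_slice i phi x : measurable_rV phi ->
  measurable_fun (setT : set mR) (fun t => phi (setcoord i t x)).
Proof. by move=> mphi; exact: measurableT_comp mphi (measurable_setcoord1 i x). Qed.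

Lemma bounded_slice i phi x u : bounded_in S phi -> S x -> a 0 i <= u ->
  bounded_in `[u, b 0 i]%classic (fun t => phi (setcoord i t x)).
Proof.
move=> [M M0 pM] Sx au; exists M => // t /=; rewrite in_itv/= => /andP[ut tb].
by apply: pM; apply: box_setcoord => //; rewrite tb (le_trans au).
Qed.

Lemma measurable_upper_primitive1 i phi : measurable_rV phi ->
  measurable_rV (U i phi).
Proof.
move=> mphi.
pose h (p : 'rV[R]_d * mR) : R :=
  if (p.1 0 i <= p.2) && (p.2 <= b 0 i) then phi (setcoord i p.2 p.1) else 0.
have mh : measurable_fun setT h.
  apply: measurable_fun_ifT => //; last exact: measurableT_comp mphi (measurable_setcoord i).
  apply: measurable_and.
    apply: measurable_fun_ler; last exact: measurable_snd.
    exact: measurableT_comp (measurable_rV_coord i) measurable_fst.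
  by apply: measurable_fun_ler => //; exact: measurable_snd.
have -> : U i phi = fun x => fine (\int[leb]_t (h (x, t))%:E)%E.
  apply/funext => x; rewrite /upper_primitive1 /Rintegral integral_mkcond.
  congr fine; apply: eq_integral => t _; rewrite patchE mem_setE in_itv/= /h/=.
  by case: ifP.
apply: measurableT_comp; first exact: fine_measurable.
under eq_fun do rewrite integralE.
have mhE : measurable_fun setT (EFin \o h) by exact/measurable_EFinP.
apply: emeasurable_funB.
  have := @measurable_fun_fubini_tonelli_F _ _ _ _ _ leb _ (measurable_funepos mhE)
    (fun _ => funepos_ge0 _ _).
  by apply: eq_measurable_fun => x _; apply: eq_integral => t _; rewrite !funeposE.
have := @measurable_fun_fubini_tonelli_F _ _ _ _ _ leb _ (measurable_funeneg mhE)
  (fun _ => funeneg_ge0 _ _).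
by apply: eq_measurable_fun => x _; apply: eq_integral => t _; rewrite !funenegE.
Qed.

Lemma measurable_coord_integral i phi : measurable_rV phi ->
  measurable_rV (V i phi).
Proof.
move=> mphi; rewrite (_ : V i phi = fun x => U i phi (setcoord i (a 0 i) x)).
  exact: measurableT_comp (measurable_upper_primitive1 i mphi) (measurable_setcoord2 i _).
by apply/funext => x; exact: coord_integralE.
Qed.

Lemma bounded_upper_primitive1 i phi : measurable_rV phi ->
  bounded_in S phi -> bounded_in S (U i phi).
Proof.
move=> mphi [M M0 pM]; exists (M * (b 0 i - a 0 i)).
  by rewrite mulr_ge0// subr_ge0 ltW.
move=> x Sx; have /andP[ax xb] := Sx i.
apply: (@le_trans _ _ (M * fine (leb `[x 0 i, b 0 i]%classic))).
  apply: le_normr_Rintegral_bounded => //.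
  - exact: lebesgue_itv_lty.
  - by apply: measurable_funTS; exact: measurable_slice.
  - move=> t; rewrite /= in_itv/= => /andP[xt tb].
    by apply: pM; apply: box_setcoord => //; rewrite tb (le_trans ax).
rewrite ler_wpM2l// lebesgue_measure_itv/= lte_fin.
by case: ltP => _ /=; [rewrite lerB|rewrite subr_ge0 ltW].
Qed.

Lemma box_setcoord_lower i x : S x -> S (setcoord i (a 0 i) x).
Proof. by move=> Sx; apply: box_setcoord => //; rewrite lexx ltW. Qed.

Lemma bounded_coord_integral i phi : measurable_rV phi ->
  bounded_in S phi -> bounded_in S (V i phi).
Proof.
move=> mphi /(bounded_upper_primitive1 i mphi)[M M0 pM]; exists M => // x Sx.
by rewrite coord_integralE; apply/pM/box_setcoord_lower.
Qed.

(** Fubini's theorem on [a_i, b_i] times [x_j, b_j].  This is why the primitive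
    in coordinate [j] preserves centering on [i]. *)
Lemma coord_integral_upper_primitive1 i j phi x : i != j ->
  measurable_rV phi -> bounded_in S phi -> S x ->
  V i (U j phi) x = U j (V i phi) x.
Proof.
move=> ij mphi [M M0 pM] Sx.
pose h (p : mR * mR) : R := phi (setcoord j p.2 (setcoord i p.1 x)).
have mh : measurable_fun setT h.
  apply: (measurableT_comp mphi).
  apply: (measurableT_comp (measurable_setcoord j)
    (g := fun p : mR * mR => (setcoord i p.1 x, p.2))).
  apply: measurable_fun_pair; last exact: measurable_snd.
  exact: measurableT_comp (measurable_setcoord1 i x) measurable_fst.
transitivity (\int[leb]_(t in `[a 0 i, b 0 i]) \int[leb]_(s in `[x 0 j, b 0 j]) h (t, s)).
  apply: eq_Rintegral => t _; rewrite /upper_primitive1 setcoordE.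
  by rewrite eq_sym (negbTE ij).
have m1 : measurable (`[a 0 i, b 0 i]%classic : set mR) by exact: measurable_itv.
have m2 : measurable (`[x 0 j, b 0 j]%classic : set mR) by exact: measurable_itv.
have bh : bounded_in (`[a 0 i, b 0 i]%classic `*` `[x 0 j, b 0 j]%classic) h.
  exists M => // -[t s] [/=]; rewrite !in_itv/= => tab /andP[xs sb].
  apply/pM/box_setcoord; first exact: box_setcoord.
  by rewrite sb (le_trans _ xs)//; case/andP: (Sx j).
rewrite (Rintegral_swap m1 m2 (lebesgue_itv_lty _ _) (lebesgue_itv_lty _ _) mh bh).
apply: eq_Rintegral => s _; apply: eq_Rintegral => t _.
by rewrite /h/= setcoordC 1?eq_sym.
Qed.

(** On almost every line in direction [i], the two functions agree almost
    everywhere, hence have the same primitive. *)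
Lemma ae_eq_upper_primitive1 i phi psi : measurable_rV phi -> measurable_rV psi ->
  (\forall x \ae lebesgue_rV, S x -> phi x = psi x) ->
  \forall x \ae lebesgue_rV, S x -> U i phi x = U i psi x.
Proof.
move=> mphi mpsi; have ab' j : a 0 j <= b 0 j by exact: ltW.
move=> /(ae_setcoord ab' i); apply: filterS => x /[swap] Sx /(_ Sx) E.
rewrite /upper_primitive1 /Rintegral; congr fine; apply: ae_eq_integral => //.
- by apply/measurable_EFinP; apply: measurable_funTS; exact: measurable_slice.
- by apply/measurable_EFinP; apply: measurable_funTS; exact: measurable_slice.
- move: E; apply: (@filterS _ _ (ae_filter_ringOfSetsType leb)) => t Et.
  rewrite /= in_itv/= => /andP[xt tb]. congr EFin; apply: Et; rewrite in_itv/= tb.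
  by rewrite (le_trans _ xt)//; case/andP: (Sx i).
Qed.

Lemma ae_eq_coord_integral i phi psi : measurable_rV phi -> measurable_rV psi ->
  (\forall x \ae lebesgue_rV, S x -> phi x = psi x) ->
  \forall x \ae lebesgue_rV, S x -> V i phi x = V i psi x.
Proof.
move=> mphi mpsi; have ab' j : a 0 j <= b 0 j by exact: ltW.
move=> /(ae_setcoord ab' i); apply: filterS => x /[swap] Sx /(_ Sx) E.
rewrite /V /Rintegral; congr fine; apply: ae_eq_integral => //.
- by apply/measurable_EFinP; apply: measurable_funTS; exact: measurable_slice.
- by apply/measurable_EFinP; apply: measurable_funTS; exact: measurable_slice.
- move: E; apply: (@filterS _ _ (ae_filter_ringOfSetsType leb)) => t Et tab.
  by congr EFin; exact: Et.
Qed.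

End coordinate_integrals.

(** * Integration by parts on a box *)

Section box_by_parts.
Context (R : realType) (d : nat) (a b : 'rV[R]_d) (ab : forall i, a 0 i < b 0 i).
Implicit Types (i j : 'I_d) (phi psi : 'rV[R]_d -> R).
Local Notation S := (box a b).
Local Notation U := (upper_primitive1 b).
Local Notation V := (coord_integral a b).
Local Notation mR := (measurableTypeR R).
Local Notation leb := (@lebesgue_measure R).
Local Notation measurable_rV := (measurable_fun (setT : set 'rV[R]_d)).

Let ab' j : a 0 j <= b 0 j. Proof. exact: ltW. Qed.

Let mS : measurable S. Proof. exact: measurable_box. Qed.

Lemma lebesgue_box_lty : (lebesgue_rV S < +oo)%E.
Proof. by rewrite lebesgue_rV_boxE ltry. Qed.

Lemma upper_primitive1_half i phi x : measurable_rV phi -> bounded_in S phi ->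
  S x -> V i phi x = 0 ->
  (`|U i phi x|%:E <=
    (2^-1)%:E * \int[leb]_(t in `[a 0%R i, b 0%R i]) `|phi (setcoord i t x)|%:E)%E.
Proof.
move=> mphi bphi Sx V0.
have mx := measurable_slice i x mphi.
have bx := bounded_slice (i := i) bphi Sx (lexx _).
rewrite -EFin_Rintegral//; last 3 first.
- exact: lebesgue_itv_lty.
- by apply: measurable_funTS; exact: measurableT_comp.
- by have [M M0 pM] := bx; exists M => // t tab; rewrite normr_id pM.
by rewrite -EFinM lee_fin; apply: mean_zero_half_bound => //; exact: Sx.
Qed.

Lemma Rintegral_coord_integral i phi : measurable_rV phi -> bounded_in S phi ->
  \int[lebesgue_rV]_(x in S) V i phi x =
  (b 0 i - a 0 i) * \int[lebesgue_rV]_(x in S) phi x.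
Proof.
move=> mphi [M M0 pM].
(* The nonnegative function [pos] equals [phi + M] on the box, where Tonelli's
   theorem applies to it. *)
pose phi' x := phi x + M.
pose pos x : R := Num.max (phi' x) 0.
have mpos : measurable_rV pos.
  by apply: measurable_maxr => //; exact: measurable_funD.
have posE x : S x -> pos x = phi x + M.
  by move=> Sx; rewrite /pos /phi' max_l// -lerBlDr sub0r lerNl; have := pM _ Sx;
    rewrite ler_norml => /andP[? _]; rewrite lerNl.
have bpos : bounded_in S pos.
  exists (M + M); first by rewrite addr_ge0.
  move=> x Sx; rewrite posE// (le_trans (ler_normD _ _))// lerD ?pM//.
  by rewrite ger0_norm.
have bphi : bounded_in S phi by exists M.
have key : \int[lebesgue_rV]_(x in S) V i pos x =
  (b 0 i - a 0 i) * \int[lebesgue_rV]_(x in S) pos x.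
  apply: EFin_inj; rewrite EFinM !EFin_Rintegral//;
    try exact: lebesgue_box_lty; try exact: measurable_funTS; last 2 first.
  - by apply: measurable_funTS; exact: measurable_coord_integral.
  - exact: bounded_coord_integral.
  rewrite -(ge0_integral_setcoord ab' i (F := EFin \o pos)); last 2 first.
  - exact/measurable_EFinP.
  - by move=> x; rewrite lee_fin le_max lexx orbT.
  apply: eq_integral => x; rewrite inE => Sx.
  rewrite /coord_integral EFin_Rintegral//; first exact: lebesgue_itv_lty.
  - by apply: measurable_funTS; exact: measurable_slice.
  - exact: (bounded_slice (i := i) bpos Sx (lexx _)).
have iphi : lebesgue_rV.-integrable S (EFin \o phi).
  apply: bounded_in_integrable => //; first exact: lebesgue_box_lty.
  exact: measurable_funTS.
have iM c : lebesgue_rV.-integrable S (EFin \o cst c).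
  apply: bounded_in_integrable => //; first exact: lebesgue_box_lty.
  by exists `|c|.
have iV : lebesgue_rV.-integrable S (EFin \o V i phi).
  apply: bounded_in_integrable => //; first exact: lebesgue_box_lty.
    by apply: measurable_funTS; exact: measurable_coord_integral.
  exact: bounded_coord_integral.
have c0 : 0 <= b 0 i - a 0 i by rewrite subr_ge0.
have posI : \int[lebesgue_rV]_(x in S) pos x =
    \int[lebesgue_rV]_(x in S) phi x + \int[lebesgue_rV]_(x in S) cst M x.
  rewrite -(RintegralD mS iphi (iM M)).
  by apply: eq_Rintegral => x; rewrite inE => Sx; rewrite posE.
have VposI : \int[lebesgue_rV]_(x in S) V i pos x =
    \int[lebesgue_rV]_(x in S) V i phi x +
    (b 0 i - a 0 i) * \int[lebesgue_rV]_(x in S) cst M x.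
  rewrite -(RintegralZl _ mS (iM M)) -(RintegralD mS iV (iM ((b 0 i - a 0 i) * M))).
  apply: eq_Rintegral => x; rewrite inE => Sx; rewrite /coord_integral.
  transitivity (\int[leb]_(t in `[a 0 i, b 0 i]) (phi (setcoord i t x) + cst M t)).
    apply: eq_Rintegral => t; rewrite inE/= in_itv/= => tab.
    by rewrite posE//; exact: box_setcoord.
  rewrite RintegralD//; last 2 first.
  - apply: bounded_itv_integrable; first exact: measurable_slice.
    exact: (bounded_slice (i := i) bphi Sx (lexx _)).
  - by apply: bounded_itv_integrable => //; exists M => // t _; rewrite ger0_norm.
  congr (_ + _).
  transitivity (fine (\int[leb]_(t in `[a 0%R i, b 0%R i]) (cst M%:E t))%E) => //.
  rewrite integral_cst//= lebesgue_measure_itv/= lte_fin ab.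
  by rewrite -EFinB -EFinM/= mulrC.
by apply: (addIr ((b 0 i - a 0 i) * \int[lebesgue_rV]_(x in S) cst M x));
  rewrite -VposI key posI mulrDr.
Qed.

(** A face is a degenerate box. *)
Lemma ae_box_interior :
  \forall x \ae lebesgue_rV, S x -> forall j, a 0 j < x 0 j < b 0 j.
Proof.
have face j c : \forall x \ae (@lebesgue_rV R d), S x -> x 0 j != c.
  exists (box (setcoord j c a) (setcoord j c b)); split.
  - exact: measurable_box.
  - by rewrite lebesgue_rV_boxE (bigD1 j)//= !setcoord_id subrr maxxx mul0r.
  - move=> x /= /not_implyP[Sx /negP]; rewrite negbK => /eqP xj k.
    by rewrite !setcoordE; case: eqP => [->|_]; [rewrite xj lexx|exact: Sx].
have : \forall x \ae lebesgue_rV, forall j, S x -> a 0 j < x 0 j < b 0 j.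
  apply: filter_forall => j; apply: filterS2 (face j (a 0 j)) (face j (b 0 j)).
  move=> x xa xb Sx; have /andP[ax bx] := Sx j.
  by rewrite !lt_neqAle ax bx (xb Sx) eq_sym (xa Sx).
by apply: filterS => x H Sx j; exact: H.
Qed.

(** Integrate [Rintegral_by_parts] over almost all lines, those through the
    interior.  Regularity on such lines is a hypothesis here because [G] and [H]
    will be extensions of derivatives known in the interior only. *)
Lemma box_by_parts i psi (G H : 'rV[R]_d -> R) :
  measurable_rV psi -> bounded_in S psi ->
  measurable_rV G -> bounded_in S G -> measurable_rV H -> bounded_in S H ->
  (\forall x \ae lebesgue_rV, S x -> V i psi x = 0) ->
  (forall x : 'rV[R]_d, (forall j, a 0 j < x 0 j < b 0 j) ->
    [/\ {within `[a 0 i, b 0 i]%classic, continuous (fun t => H (setcoord i t x))},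
        derivable_oo_LRcontinuous (fun t => G (setcoord i t x)) (a 0 i) (b 0 i) &
        {in `]a 0 i, b 0 i[, (fun t => G (setcoord i t x))^`()%classic =1
                             (fun t => H (setcoord i t x))}]) ->
  \int[lebesgue_rV]_(x in S) (psi x * G x) =
  \int[lebesgue_rV]_(x in S) (U i psi x * H x).
Proof.
move=> mpsi bpsi mG bG mH bH V0 GH.
have c0 : b 0 i - a 0 i != 0 by rewrite subr_eq0 gt_eqF.
have mU := measurable_upper_primitive1 b i mpsi.
have bU := bounded_upper_primitive1 ab i mpsi bpsi.
have m1 : measurable_rV (fun x => psi x * G x) by exact: measurable_funM.
have m2 : measurable_rV (fun x => U i psi x * H x) by exact: measurable_funM.
have b1 := bounded_inM bpsi bG; have b2 := bounded_inM bU bH.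
apply: (mulfI c0); rewrite -!Rintegral_coord_integral//.
rewrite /Rintegral; congr fine; apply: ae_eq_integral => //.
- by apply/measurable_EFinP; apply: measurable_funTS; exact: measurable_coord_integral.
- by apply/measurable_EFinP; apply: measurable_funTS; exact: measurable_coord_integral.
apply: filterS2 V0 ae_box_interior => x V0 xint Sx; congr EFin.
have [cH dG Gd] := GH x (xint Sx).
rewrite /coord_integral.
transitivity (\int[leb]_(s in `[a 0 i, b 0 i])
  ((\int[leb]_(t in `[s, b 0 i]) psi (setcoord i t x)) * H (setcoord i s x))).
  apply: Rintegral_by_parts => //; first exact: measurable_slice.
    exact: (bounded_slice (i := i) bpsi Sx (lexx _)).
  exact: V0.
apply: eq_Rintegral => s _; congr (_ * _).
by rewrite /upper_primitive1 setcoord_id; apply: eq_Rintegral => t _; rewrite setcoord_setcoord.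
Qed.

End box_by_parts.

(** * Functions continuous on a box *)

Section rV_topology.
Context (R : realType) (n : nat).

Lemma rV_continuous (T : topologicalType) (f : T -> 'rV[R]_n) :
  (forall j, continuous (fun x => f x 0 j)) -> continuous f.
Proof.
move=> cf x A [P Px PA]; have : \forall y \near x, forall j, P 0 j (f y 0 j).
  by apply: filter_forall => j; exact: cf (Px 0 j).
by apply: filterS => y Py; apply: PA => i j; rewrite ord1; exact: Py.
Qed.

(** Boxes with rational corners form a countable base. *)
Lemma measurable_open_rV (A : set 'rV[R]_n) : open A -> measurable A.
Proof.
move=> oA; pose B (uv : 'rV[rat]_n * 'rV[rat]_n) : set 'rV[R]_n :=
  box (map_mx ratr uv.1) (map_mx ratr uv.2).
pose C uv := if pselect (B uv `<=` A) then B uv else set0.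
rewrite (_ : A = \bigcup_uv C uv); last first.
  apply/seteqP; split => [x Ax|x [uv _]]; last first.
    by rewrite /C; case: pselect => // BA; exact: BA.
  have /= [P Px PA] := open_nbhs_nbhs (conj oA Ax).
  have rat_nbhd j : exists uv : rat * rat, ratr uv.1 <= x 0 j <= ratr uv.2 /\
      (forall t : R, ratr uv.1 <= t <= ratr uv.2 -> P 0 j t).
    have /nbhs_ballP[e /= e0 eP] := Px 0 j.
    have xl : x 0 j - e < x 0 j by rewrite ltrBlDr ltrDl.
    have xr : x 0 j < x 0 j + e by rewrite ltrDl.
    have [u] := rat_in_itvoo xl; rewrite in_itv/= => /andP[xu ux].
    have [v] := rat_in_itvoo xr; rewrite in_itv/= => /andP[xv vx].
    exists (u, v); rewrite /= !ltW//; split => // t /andP[ut tv].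
    apply: eP; rewrite /ball/= ltr_distlC (lt_le_trans xu)//=.
    by rewrite (le_lt_trans tv).
  have [uv uvP] := choice rat_nbhd.
  exists (\row_j (uv j).1, \row_j (uv j).2) => //.
  rewrite /C; case: pselect => [_ j|[]] /=; first by rewrite !mxE; exact: (uvP j).1.
  move=> y By; apply: PA => i j; rewrite ord1; apply: (uvP j).2.
  by have := By j; rewrite !mxE.
apply: countable_bigcupT_measurable; first exact: countableP.
by move=> uv; rewrite /C; case: pselect => [?|?]; [exact: measurable_box|exact: measurable0].
Qed.

Lemma measurable_continuous_rV (f : 'rV[R]_n -> R) :
  continuous f -> measurable_fun setT f.
Proof.
move=> cf; apply: (measurability (@RGenOInfty.G R)).
  exact: RGenOInfty.measurableE.
move=> _ [_ [x ->] <-]; rewrite setTI; apply: measurable_open_rV.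
apply: open_comp; last exact: interval_open.
by move=> y _; exact: cf.
Qed.

Context (a b : 'rV[R]_n) (ab : forall i, a 0 i <= b 0 i).

Lemma compact_box : compact (box a b).
Proof.
have := @rV_compact R n (fun i => `[a 0 i, b 0 i]%classic)
  (fun i => @segment_compact R _ _).
by congr compact; apply/seteqP; split => x /= H i; have := H i; rewrite /= in_itv.
Qed.

Lemma box_interior (x : 'rV[R]_n) :
  (forall i, a 0 i < x 0 i < b 0 i) -> (box a b)° x.
Proof.
move=> axb; exists (fun _ j => `]a 0 j, b 0 j[%classic).
  move=> i j; rewrite ord1; apply: open_nbhs_nbhs; split; first exact: interval_open.
  by rewrite /= in_itv/= axb.
move=> y /= yab j; have := yab 0 j; rewrite in_itv/= => /andP[/ltW -> /ltW ->].
by [].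
Qed.

Definition clamp (x : 'rV[R]_n) : 'rV[R]_n :=
  \row_j Num.max (a 0 j) (Num.min (b 0 j) (x 0 j)).

Lemma clamp_box x : box a b (clamp x).
Proof. by move=> j; rewrite mxE le_max lexx/= ge_max ab ge_min lexx. Qed.

Lemma clamp_id x : box a b x -> clamp x = x.
Proof.
move=> Sx; apply/rowP => j; rewrite mxE; have /andP[ax xb] := Sx j.
by rewrite min_r// max_r.
Qed.

Lemma continuous_clamp : continuous clamp.
Proof.
apply: rV_continuous => j x; rewrite (_ : (fun y => clamp y 0 j) =
  (fun y : 'rV[R]_n => Num.max (a 0 j) (Num.min (b 0 j) (y 0 j)))).
  have cc (c : R) : {for x, continuous (cst c : 'rV[R]_n -> R^o)}.
    exact: cst_continuous.
  apply: (continuous_max (cc (a 0 j))).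
  by apply: (continuous_min (cc (b 0 j))); exact: coord_continuous.
by apply/funext => y; rewrite mxE.
Qed.

(** [f \o clamp] extends [f] from the box to the whole space. *)
Lemma continuous_comp_clamp (f : 'rV[R]_n -> R) :
  {within box a b, continuous f} -> continuous (f \o clamp).
Proof.
move=> /subspace_continuousP cf x B /= Bfx.
have H := cf _ (clamp_box x) B Bfx.
have H2 : \forall y \near x, box a b (clamp y) -> B (f (clamp y)).
  exact: (@continuous_clamp x _ H).
change (\forall y \near x, B (f (clamp y))).
by apply: filterS H2 => y; apply; exact: clamp_box.
Qed.
End rV_topology.

Section box_derivatives.
Context (R : realType) (d : nat) (a b : 'rV[R]_d) (ab : forall i, a 0 i < b 0 i).
Local Notation S := (box a b).

(** Every half-open segment from the centre of the box to [x] is interior. *)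
Lemma box_closure_interior x : S x -> closure S° x.
Proof.
move=> Sx B xB.
pose z (t : R) : 'rV[R]_d := \row_j (x 0 j + t * ((a 0 j + b 0 j) / 2 - x 0 j)).
have zc : {for 0, continuous z}.
  apply: rV_continuous => j t; rewrite (_ : (fun u => z u 0 j) =
    (fun u => x 0 j + u * ((a 0 j + b 0 j) / 2 - x 0 j))); last first.
    by apply/funext => u; rewrite mxE.
  by apply: cvgD; [exact: cvg_cst|apply: cvgM; [exact: cvg_id|exact: cvg_cst]].
have z0 : z 0 = x by apply/rowP => j; rewrite mxE mul0r addr0.
have /nbhs_ballP[e /= e0 eB] : nbhs (0 : R) (z @^-1` B) by apply: zc; rewrite z0.
pose t := Num.min (e / 2) 1.
have t0 : 0 < t by rewrite lt_min divr_gt0 ?ltr01.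
have t1 : t <= 1 by rewrite ge_min lexx orbT.
exists (z t); split; last first.
  apply: eB; rewrite /ball/= sub0r normrN gtr0_norm// gt_min.
  by rewrite ltr_pdivrMr// ltr_pMr// ltr1n.
apply: box_interior => j; rewrite mxE.
have /andP[ax xb] := Sx j; have abj := ab j.
by clear -t0 t1 ax xb abj; apply/andP; split; nra.
Qed.

Lemma pderiv_closureE (g f : 'rV[R]_d -> R) (s : seq 'I_d) x :
  {within S, continuous g} -> (forall y, S° y -> g y = pderiv s f y) ->
  S x -> pderiv_closure S s f x = g x.
Proof.
move=> /subspace_continuousP cg gE Sx.
have clx := box_closure_interior Sx.
have PF : ProperFilter (within S° (nbhs x)) by exact: within_nbhs_proper.
apply: cvg_lim => // B Bgx.
have H : \forall y \near x, S y -> B (g y) := cg _ Sx B Bgx.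
change (\forall y \near x, S° y -> B (pderiv s f y)).
apply: filterS H => y + yS; rewrite gE//; apply.
exact: interior_subset.
Qed.

Lemma setcoord_shift (i : 'I_d) (x : 'rV[R]_d) (t h : R) :
  setcoord i (h + t) x = h *: delta_mx 0 i + setcoord i t x.
Proof.
apply/rowP => j; rewrite !mxE eqxx; have [_|_] /= := eqVneq j i.
  by rewrite mulr1.
by rewrite mulr0 add0r.
Qed.

Lemma slice_derivable (G : 'rV[R]_d -> R) i x t :
  derivable G (setcoord i t x) (delta_mx 0 i) ->
  derivable (fun u : R => G (setcoord i u x)) t 1 /\
  (fun u : R => G (setcoord i u x))^`()%classic t = 'D_(delta_mx 0 i) G (setcoord i t x).
Proof.
have E : (fun h : R => h^-1 *: (((fun u : R => G (setcoord i u x)) \o shift t) (h *: 1) -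
      G (setcoord i t x))) =
    (fun h => h^-1 *: ((G \o shift (setcoord i t x)) (h *: delta_mx 0 i) - G (setcoord i t x))).
  apply/funext => h; rewrite /= /shift/= -setcoord_shift.
  by rewrite [h *: 1]mulr1.
by rewrite derive1E /derivable /derive E.
Qed.

Lemma continuous_slice (G : 'rV[R]_d -> R) i x :
  continuous G -> continuous (fun t : R => G (setcoord i t x)).
Proof.
move=> cG t.
apply: (@continuous_comp R 'rV[R]_d R (fun t => setcoord i t x) G); last exact: cG.
apply: rV_continuous => j u; rewrite (_ : (fun t => _) =
  (fun t : R => if j == i then t else x 0 j)).
  by case: eqP => _; [exact: cvg_id|exact: cvg_cst].
by apply/funext => v; rewrite setcoordE.
Qed.

(** The extensions [G] and [H] agree with the iterated derivatives of [f] near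
    interior points, so that the derivative of [G] along a line is [H]. *)
Lemma slice_by_parts_hyps (f G H : 'rV[R]_d -> R) i s (x : 'rV[R]_d) :
  continuous G -> continuous H ->
  (forall y, S° y -> G y = pderiv s f y) ->
  (forall y, S° y -> H y = pderiv (i :: s) f y) ->
  (forall y, S° y -> derivable (pderiv s f) y (delta_mx 0 i)) ->
  (forall j, a 0 j < x 0 j < b 0 j) ->
  [/\ {within `[a 0 i, b 0 i]%classic, continuous (fun t => H (setcoord i t x))},
      derivable_oo_LRcontinuous (fun t => G (setcoord i t x)) (a 0 i) (b 0 i) &
      {in `]a 0 i, b 0 i[, (fun t => G (setcoord i t x))^`()%classic =1
                           (fun t => H (setcoord i t x))}].
Proof.
move=> cG cH GE HE df xab.
have int t : t \in `]a 0 i, b 0 i[ -> S° (setcoord i t x).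
  rewrite in_itv/= => tab; apply: box_interior => j; rewrite setcoordE.
  by case: eqP => // ->.
have near_eq y : S° y -> \forall z \near y, pderiv s f z = G z.
  move=> Sy; have : nbhs y S° by exact: nbhs_interior Sy.
  by apply: filterS => z Sz; rewrite GE.
have dG t : t \in `]a 0 i, b 0 i[ -> derivable G (setcoord i t x) (delta_mx 0 i).
  move=> /int St; apply: near_eq_derivable (df _ St); exact: near_eq.
have cs := continuous_slice cG (i := i) (x := x).
split.
- by apply: continuous_subspaceT; exact: continuous_slice.
- split.
  + by move=> t /dG /slice_derivable[].
  + exact/cvg_at_right_filter/cs.
  + exact/cvg_at_left_filter/cs.
- move=> t tab; have [_ ->] := slice_derivable (dG t tab).
  rewrite HE/=; last exact: int.
  by apply/esym/near_eq_derive; apply: near_eq; exact: int.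
Qed.

End box_derivatives.

(** * Iterated integrals *)

Lemma ge0_integral_rV_cons (R : realType) n (F : 'rV[R]_n.+1 -> \bar R) (u v : 'rV[R]_n.+1) :
  measurable_fun setT F -> (forall x, (0 <= F x)%E) ->
  (\int[lebesgue_rV]_(x in box u v) F x =
   \int[lebesgue_measure]_(t in `[u 0%R 0%R, v 0%R 0%R])
     \int[lebesgue_rV]_(x in box (\row_j u 0%R (lift 0%R j)) (\row_j v 0%R (lift 0%R j)))
       F (rV_cons (t, x)))%E.
Proof.
move=> mF F0; set u' := \row_j u _ _; set v' := \row_j v _ _.
have mB : measurable (box u v) by exact: measurable_box.
have mB' : measurable ((`[u 0 0, v 0 0]%classic : set (measurableTypeR R)) `*` box u' v').
  by apply: measurableX => //; exact: measurable_box.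
have preB : @rV_cons R n @^-1` (box u v) = `[u 0 0, v 0 0]%classic `*` box u' v'.
  apply/seteqP; split => -[t x] /=.
    move=> H; split => [|j]; first by have := H 0; rewrite mxE unlift_none in_itv.
    by have := H (lift 0 j); rewrite !mxE liftK.
  move=> [tab xab] i; rewrite mxE; case: unliftP => [j ->|->].
    by have := xab j; rewrite !mxE.
  by move: tab; rewrite in_itv.
have PF := @ge0_integral_pushforward _ _ _ _ _ _ (@measurable_rV_cons R n)
  (lebesgue_measure \x lebesgue_rV)%E (box u v) F mB (measurable_funTS mF) (fun x _ => F0 x).
rewrite [LHS]PF preB [LHS]integral_mkcond fubini_tonelli1; last 2 first.
- apply/(measurable_restrictT _ mB'); apply: measurable_funTS.
  exact: measurableT_comp mF (@measurable_rV_cons R n).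
- by move=> p; rewrite patchE; case: ifP => // _; exact: F0.
rewrite [RHS]integral_mkcond; apply: eq_integral => t _; rewrite /fubini_F patchE.
case: ifPn => tI.
  rewrite [RHS]integral_mkcond; apply: eq_integral => x _.
  by rewrite !patchE in_setX/= tI.
by rewrite integral0_eq// => x _; rewrite patchE in_setX/= (negbTE tI).
Qed.

Section iterated.
Context (R : realType) (d : nat) (a b : 'rV[R]_d) (ab : forall i, a 0 i <= b 0 i).
Local Notation S := (box a b).
Local Notation measurable_rV := (measurable_fun (setT : set 'rV[R]_d)).
Implicit Types (F G : 'rV[R]_d -> \bar R).

(** The analogue of [coord_integral] for the nonnegative functions that enter
    the envelope, which need not be bounded. *)
Definition coord_eintegral (i : 'I_d) F (x : 'rV[R]_d) : \bar R :=
  (\int[lebesgue_measure]_(t in `[a 0%R i, b 0%R i]) F (setcoord i t x))%E.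

Lemma coord_eintegral_ge0 i F : (forall x, (0 <= F x)%E) ->
  forall x, (0 <= coord_eintegral i F x)%E.
Proof. by move=> F0 x; apply: integral_ge0. Qed.

Lemma iter_coord_eintegral_ge0 s F : (forall x, (0 <= F x)%E) ->
  forall x, (0 <= foldr coord_eintegral F s x)%E.
Proof. by move=> F0; elim: s => //= i s ih; exact: coord_eintegral_ge0. Qed.

Lemma measurable_iter_coord_eintegral s F :
  measurable_rV F -> (forall x, (0 <= F x)%E) ->
  measurable_rV (foldr coord_eintegral F s).
Proof.
move=> mF F0; elim: s => //= i s ih.
by apply: measurable_ge0_integral_setcoord => //; exact: iter_coord_eintegral_ge0.
Qed.

Lemma ae_le_coord_eintegral i F G : measurable_rV F -> measurable_rV G ->
  (forall x, (0 <= F x)%E) -> (forall x, (0 <= G x)%E) ->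
  (\forall x \ae lebesgue_rV, S x -> (F x <= G x)%E) ->
  \forall x \ae lebesgue_rV, S x -> (coord_eintegral i F x <= coord_eintegral i G x)%E.
Proof.
move=> mF mG F0 G0 /(ae_setcoord ab i); apply: filterS => x FG Sx.
apply: ae_ge0_le_integral => //.
- by apply: measurable_funTS; apply: measurableT_comp (measurable_setcoord1 i x).
- by apply: measurable_funTS; apply: measurableT_comp (measurable_setcoord1 i x).
- exact: FG.
Qed.

Lemma ae_le_iter_coord_eintegral s F G : measurable_rV F -> measurable_rV G ->
  (forall x, (0 <= F x)%E) -> (forall x, (0 <= G x)%E) ->
  (\forall x \ae lebesgue_rV, S x -> (F x <= G x)%E) ->
  \forall x \ae lebesgue_rV, S x ->
    (foldr coord_eintegral F s x <= foldr coord_eintegral G s x)%E.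
Proof.
move=> mF mG F0 G0 FG; elim: s => //= i s ih.
by apply: ae_le_coord_eintegral => //;
  [exact: measurable_iter_coord_eintegral..|exact: iter_coord_eintegral_ge0|
   exact: iter_coord_eintegral_ge0].
Qed.

(** For [e = enum_val] this is [glue] (see [glue_overwrite]).  Allowing any
    enumeration [e] makes induction on the number of coordinates possible. *)
Definition overwrite n (e : 'I_n -> 'I_d) (x : 'rV[R]_d) (t : 'rV[R]_n) : 'rV[R]_d :=
  \row_i if [pick k | e k == i] is Some k then t 0 k else x 0 i.

Lemma overwrite_val n (e : 'I_n -> 'I_d) x t : injective e ->
  (forall k, overwrite e x t 0 (e k) = t 0 k) /\
  (forall i, (forall k, e k != i) -> overwrite e x t 0 i = x 0 i).
Proof.
move=> ei; split => [k|i ne]; rewrite mxE; case: pickP => [l /eqP|]//.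
- by move/ei => ->.
- by move=> /(_ k); rewrite eqxx.
- by move=> /eqP; rewrite (negbTE (ne l)).
Qed.

Lemma overwrite_cons n (e : 'I_n.+1 -> 'I_d) x t0 t : injective e ->
  overwrite e x (rV_cons (t0, t)) =
  overwrite (e \o lift 0) (setcoord (e 0) t0 x) t.
Proof.
move=> ei; have ei' : injective (e \o lift 0) by apply: inj_comp => //; exact: lift_inj.
apply/rowP => i; have [[k <-]|ne] := pselect (exists k, e k = i).
  rewrite (overwrite_val x _ ei).1 mxE; case: unliftP => [j ->|->].
    by rewrite -[e (lift 0 j)]/((e \o lift 0) j) (overwrite_val _ _ ei').1.
  rewrite (overwrite_val _ _ ei').2 ?setcoord_id// => k'.
  by rewrite /= (inj_eq ei) eq_sym neq_lift.
have ne' k : e k != i by apply/eqP => ki; apply: ne; exists k.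
rewrite (overwrite_val _ _ ei).2// (overwrite_val _ _ ei').2//; last by move=> k; exact: ne'.
by rewrite setcoordE eq_sym (negbTE (ne' 0)).
Qed.

Lemma measurable_overwrite n (e : 'I_n -> 'I_d) x :
  measurable_fun setT (overwrite e x).
Proof.
apply: measurable_fun_rVP => i.
rewrite (_ : _ \o _ = fun t => if [pick k | e k == i] is Some k then rV_coord k t else x 0 i).
  by case: pickP => [k _|_]; [exact: measurable_rV_coord|exact: measurable_cst].
by apply/funext => t; rewrite /= /rV_coord mxE; case: pickP.
Qed.

(** Both sides integrate over the coordinate [e 0] last: on the left as the head
    of the list, on the right as the first coordinate of [lebesgue_rV]. *)
Lemma iter_coord_eintegralE n (e : 'I_n -> 'I_d) F x : injective e ->
  measurable_rV F -> (forall x, (0 <= F x)%E) ->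
  foldr coord_eintegral F [seq e k | k <- enum 'I_n] x =
  (\int[lebesgue_rV]_(t in box (\row_k a 0%R (e k)) (\row_k b 0%R (e k)))
    F (overwrite e x t))%E.
Proof.
move=> + mF F0; elim: n e x => [|n ih] e x ei.
  have mG := measurableT_comp mF (measurable_overwrite e x).
  rewrite enum_ord0/= (@integral_dirac _ _ (0 : 'rV[R]_0) R _ (measurable_box _ _)
    _ (measurable_funTS mG)).
  rewrite diracE mem_set ?mul1e; last by case.
  by congr F; apply/rowP => i; rewrite (overwrite_val _ _ ei).2//; case.
rewrite enum_ordSl/= -map_comp ge0_integral_rV_cons//; last first.
  exact: measurableT_comp mF (measurable_overwrite e x).
rewrite !mxE {1}/coord_eintegral; apply: eq_integral => t _.
rewrite (ih (e \o lift 0)); last by apply: inj_comp => //; exact: lift_inj.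
have rowE (u : 'rV[R]_d) : \row_j (\row_k u 0 (e k)) 0 (lift 0 j) =
    \row_j u 0 ((e \o lift 0) j) :> 'rV[R]_n.
  by apply/rowP => j; rewrite !mxE.
by rewrite !rowE; apply: eq_integral => y _; rewrite overwrite_cons.
Qed.

End iterated.

(** * Iterated primitives *)

Section iterated_primitives.
Context (R : realType) (d : nat) (a b : 'rV[R]_d) (ab : forall i, a 0 i < b 0 i).
Local Notation S := (box a b).
Local Notation U s phi := (foldr (upper_primitive1 b) phi s).
Local Notation V := (coord_integral a b).
Local Notation measurable_rV := (measurable_fun (setT : set 'rV[R]_d)).
Implicit Types (phi psi : 'rV[R]_d -> R) (s : seq 'I_d).

Let ab' i : a 0 i <= b 0 i. Proof. exact: ltW. Qed.

Definition ae_centered i phi := \forall x \ae lebesgue_rV, S x -> V i phi x = 0.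

Lemma measurable_iter_primitive s phi :
  measurable_rV phi -> measurable_rV (U s phi).
Proof. by move=> mphi; elim: s => //= i s ih; exact: measurable_upper_primitive1. Qed.

Lemma bounded_iter_primitive s phi :
  measurable_rV phi -> bounded_in S phi -> bounded_in S (U s phi).
Proof.
move=> mphi bphi; elim: s => //= i s ih.
by apply: bounded_upper_primitive1 => //; exact: measurable_iter_primitive.
Qed.

Lemma ae_eq_iter_primitive s phi psi : measurable_rV phi -> measurable_rV psi ->
  (\forall x \ae lebesgue_rV, S x -> phi x = psi x) ->
  \forall x \ae lebesgue_rV, S x -> U s phi x = U s psi x.
Proof.
move=> mphi mpsi E; elim: s => //= i s ih.
by apply: ae_eq_upper_primitive1 => //; exact: measurable_iter_primitive.
Qed.

(** The integral over coordinate [i] moves inside every primitive in [s], where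
    it vanishes. *)
Lemma ae_centered_iter_primitive i s phi : i \notin s ->
  measurable_rV phi -> bounded_in S phi -> ae_centered i phi ->
  ae_centered i (U s phi).
Proof.
move=> + mphi bphi c; elim: s => //= j s ih; rewrite inE negb_or => /andP[ij /ih cs].
have mU := measurable_iter_primitive s mphi.
have bU := bounded_iter_primitive s mphi bphi.
have := @ae_eq_upper_primitive1 _ _ _ _ ab j (V i (U s phi)) (cst 0)
  (measurable_coord_integral a b i mU) (measurable_cst _) cs.
apply: filterS => x H Sx; rewrite coord_integral_upper_primitive1// H//.
by rewrite /upper_primitive1 /Rintegral integral0.
Qed.

(** Since [U s phi] is still centered on the next coordinate [i], its primitive
    in [i] is at most half of its [L^1] norm on lines in direction [i]. *)
Lemma iter_primitive_le s phi : uniq s ->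
  measurable_rV phi -> bounded_in S phi -> {in s, forall i, ae_centered i phi} ->
  \forall x \ae lebesgue_rV, S x ->
    (`|U s phi x|%:E <= (2 ^- size s)%:E *
       foldr (coord_eintegral a b) (fun y => `|phi y|%:E) s x)%E.
Proof.
move=> + mphi bphi; elim: s => [_ _|i s ih /= /andP[is_ us] c].
  by apply: aeW => x _; rewrite /= expr0 invr1 mul1e.
have mU := measurable_iter_primitive s mphi.
have bU := bounded_iter_primitive s mphi bphi.
have mE : measurable_rV (fun y => `|phi y|%:E).
  by apply/measurable_EFinP; exact: measurableT_comp.
have mUE : measurable_rV (fun y => `|U s phi y|%:E).
  by apply/measurable_EFinP; exact: measurableT_comp.
pose W := foldr (coord_eintegral a b) (fun y => `|phi y|%:E) s.
have W0 x : (0 <= W x)%E by apply: iter_coord_eintegral_ge0 => y; rewrite lee_fin.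
have mW : measurable_rV W by apply: measurable_iter_coord_eintegral => // y; rewrite lee_fin.
have c0 : (0 <= (2 ^- size s : R)%:E)%E by rewrite lee_fin invr_ge0 exprn_ge0.
have {}ih : \forall x \ae lebesgue_rV, S x ->
    (`|U s phi x|%:E <= (2 ^- size s)%:E * W x)%E.
  by apply: ih => // j js; apply: c; rewrite inE js orbT.
have ci : ae_centered i (U s phi).
  by apply: ae_centered_iter_primitive => //; apply: c; rewrite inE eqxx.
have := @ae_le_coord_eintegral _ _ _ _ ab' i _ _ mUE
  (emeasurable_funM (measurable_cst _) mW) (fun y => _) (fun y => mule_ge0 c0 (W0 y)) ih.
move=> /(_ (fun y => normr_ge0 _)); apply: filterS2 ci => x Ux le1 Sx.
apply: le_trans (upper_primitive1_half mU bU Sx (Ux Sx)) _.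
rewrite exprS invfM EFinM -muleA lee_wpmul2l// ?lee_fin//.
apply: le_trans (le1 Sx) _.
rewrite /coord_eintegral ge0_integralZl//.
by apply: measurable_funTS; exact: measurableT_comp mW (measurable_setcoord1 i x).
Qed.

(** Along the list, derivatives accumulate on [f] in the same order as primitives
    do on [phi]; [G] stands for the continuous extension of the derivative. *)
Lemma iter_by_parts (I : {set 'I_d}) f phi s G :
  Ck_upto_boundary #|I| S f -> (size s <= #|I|)%N -> uniq s ->
  measurable_rV phi -> bounded_in S phi -> {in s, forall i, ae_centered i phi} ->
  continuous G -> (forall y, S° y -> G y = pderiv s f y) ->
  \int[lebesgue_rV]_(x in S) (phi x * f (clamp a b x)) =
  \int[lebesgue_rV]_(x in S) (U s phi x * G x).
Proof.
move=> [cf hf] + + mphi bphi.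
have cont_bounded (H : 'rV[R]_d -> R) : continuous H -> bounded_in S H.
  by move=> cH; apply: compact_bounded_in; [exact: compact_box|exact: continuous_subspaceT].
elim: s G => [|i s ih] G /= sk us c cG GE.
  rewrite /Rintegral; congr fine.
  have cF := continuous_comp_clamp ab' cf.
  apply: ae_eq_integral => //; first exact: measurable_box.
  - apply/measurable_EFinP; apply: measurable_funTS; apply: measurable_funM => //.
    exact: measurable_continuous_rV.
  - apply/measurable_EFinP; apply: measurable_funTS; apply: measurable_funM => //.
    exact: measurable_continuous_rV.
  have := ae_box_interior a b; apply: filterS => x xint Sx.
  by rewrite GE ?clamp_id//; apply: box_interior; exact: xint.
have {us} /andP[is_ us] := us.
have [df [g cg gE]] := hf s (ltnW sk).
have cG' := continuous_comp_clamp ab' cg.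
have G'E y : S° y -> (g \o clamp a b) y = pderiv s f y.
  by move=> Sy; rewrite /= clamp_id ?gE//; exact: interior_subset Sy.
rewrite (ih (g \o clamp a b))//; [|exact: ltnW|by move=> j js; apply: c; rewrite inE js orbT].
apply: box_by_parts => //.
- exact: measurable_iter_primitive.
- exact: bounded_iter_primitive.
- exact: measurable_continuous_rV.
- exact: cont_bounded.
- exact: measurable_continuous_rV.
- exact: cont_bounded.
- by apply: ae_centered_iter_primitive => //; apply: c; rewrite inE eqxx.
- move=> x xint; apply: (slice_by_parts_hyps (f := f) (s := s)) => // y Sy.
  exact: df.
Qed.

End iterated_primitives.

(** * The mixed envelope *)

Lemma ae_lebesgue_box (R : realType) n (a b : 'rV[R]_n) (P : 'rV[R]_n -> Prop) :
  (\forall x \ae lebesgue_box a b, P x) <->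
  (\forall x \ae lebesgue_rV, box a b x -> P x).
Proof.
have mS := measurable_box a b; split => [[N [mN N0 PN]]|[N [mN N0 PN]]].
  exists (N `&` box a b); split => //; first exact: measurableI.
  by move=> x /= /not_implyP[Sx Px]; split => //; exact: PN.
exists (N `|` ~` box a b); split.
- by apply: measurableU => //; exact: measurableC.
- rewrite /lebesgue_box /= /mrestr setIUl setICl setU0.
  by apply: (subset_measure0 _ mN _ N0); [exact: measurableI|exact: subIsetl].
- move=> x /= Px; have [Sx|] := pselect (box a b x); last by right.
  by left; apply: PN => /= /(_ Sx).
Qed.

Section envelope.
Context (R : realType) (d : nat) (a b : 'rV[R]_d) (ab : forall i, a 0 i < b 0 i).
Local Notation S := (box a b).
Local Notation measurable_rV := (measurable_fun (setT : set 'rV[R]_d)).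
Implicit Types (phi : 'rV[R]_d -> R) (I : {set 'I_d}).

Lemma lebesgue_box_gt0 : (0 < lebesgue_box a b setT)%E.
Proof.
rewrite /lebesgue_box /= /mrestr setTI lebesgue_rV_boxE lte_fin.
by apply: prodr_gt0 => i _; rewrite lt_max subr_gt0 ab orbT.
Qed.

Lemma Lnorm_box_le (phi : 'rV[R]_d -> R) (K : \bar R) :
  (\forall x \ae lebesgue_rV, S x -> (`|phi x|%:E <= K)%E) ->
  ('N[lebesgue_box a b]_+oo[EFin \o phi] <= K)%E.
Proof.
move=> H; rewrite Lnorm.unlock lebesgue_box_gt0; apply/ess_supP.
exact: (ae_lebesgue_box a b _).2 H.
Qed.

Lemma Lfun_box_measurable phi : phi \in Lfun (lebesgue_box a b) +oo%E ->
  measurable_rV phi.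
Proof. by rewrite inE => /andP[]; rewrite inE. Qed.

Lemma Lfun_box_bounded phi : phi \in Lfun (lebesgue_box a b) +oo%E ->
  exists2 M, 0 <= M & \forall x \ae lebesgue_rV, S x -> `|phi x| <= M.
Proof.
rewrite inE => /andP[_]; rewrite inE/= /finite_norm Lnorm.unlock lebesgue_box_gt0.
move=> /ess_supr_bounded[M /ae_lebesgue_box phiM].
exists (Num.max M 0); first by rewrite le_max lexx orbT.
by apply: filterS phiM => x H /H; rewrite le_max => ->.
Qed.

Lemma box_subvec (J : {set 'I_d}) (x : 'rV[R]_d) :
  S x -> box (subvec J a) (subvec J b) (subvec J x).
Proof. by move=> Sx k; rewrite !mxE. Qed.

Lemma ae_subvec I (P : 'rV[R]_#|(~: I)%SET| -> Prop) :
  (\forall w \ae lebesgue_rV, P w) ->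
  \forall x \ae (@lebesgue_rV R d), P (subvec (~: I)%SET x).
Proof. exact: negligible_subvec. Qed.

Lemma glue_const (i : 'I_d) (t : R) (x : 'rV[R]_d) :
  glue (subvec [set~ i]%SET x) (const_mx t) = setcoord i t x.
Proof.
have -> : const_mx t = subvec [set i]%SET (const_mx t : 'rV[R]_d).
  by apply/rowP => k; rewrite !mxE.
by rewrite glue_subvec; apply/rowP => j; rewrite !mxE finset.in_set1.
Qed.

Lemma centered_on_ae I phi i : centered_on a b I phi -> i \in I ->
  ae_centered a b i phi.
Proof.
move=> c /c /ae_subvec; apply: filterS => x /[swap] Sx /(_ (@box_subvec _ _ Sx)) H.
rewrite /coord_integral /Rintegral -[RHS]/(fine 0%E) -H; congr fine.
by apply: eq_integral => t _; rewrite glue_const.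
Qed.

Lemma glue_overwrite I (x : 'rV[R]_d) (t : 'rV[R]_#|I|) :
  glue (subvec (~: I)%SET x) t = overwrite enum_val x t.
Proof.
apply/rowP => i; have [[k ->]|[k ->]] := enum_val_cases I i.
  by rewrite (glue_enum_val _ _).1 (overwrite_val _ _ enum_val_inj).1.
rewrite (glue_enum_val _ _).2 (overwrite_val _ _ enum_val_inj).2 ?mxE// => j.
by apply/eqP => jk; have := enum_valP k; rewrite -jk finset.in_setC enum_valP.
Qed.

Lemma enum_enum_val I : enum I = [seq enum_val k | k <- enum 'I_#|I|].
Proof.
have szE : size (enum I) = size [seq enum_val k | k <- enum 'I_#|I|].
  by rewrite size_map size_enum_ord cardE.
case: (posnP #|I|) => [I0|I0].
  have -> : enum I = [::] by apply: size0nil; rewrite -cardE.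
  by apply/esym/size0nil; rewrite size_map size_enum_ord.
pose k0 := Ordinal I0; apply: (@eq_from_nth _ (enum_val k0)) => // k.
rewrite -cardE => kI; rewrite (nth_map k0) ?size_enum_ord//.
rewrite (enum_val_nth (enum_val k0) (nth k0 _ _)).
by rewrite nth_enum_ord.
Qed.

(** The iterated integral at [x] depends on [x_{-I}] only, and it is the function
    of [x_{-I}] whose essential supremum is the envelope. *)
Lemma iter_le_mix_envelope I phi : measurable_rV phi ->
  \forall x \ae lebesgue_rV, S x ->
    (foldr (coord_eintegral a b) (fun y => `|phi y|%:E) (enum I) x
      <= mix_envelope a b I phi)%E.
Proof.
move=> mphi.
have /ae_lebesgue_box/ae_subvec := ess_sup_ge
    (lebesgue_box (subvec (~: I)%SET a) (subvec (~: I)%SET b))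
    (fun w => \int[lebesgue_rV]_(t in sub_box a b (J := I)) `|phi (glue w t)|%:E)%E.
apply: filterS => x H Sx; apply: le_trans (H (@box_subvec _ _ Sx)).
rewrite enum_enum_val iter_coord_eintegralE//.
- rewrite le_eqVlt; apply/orP; left; apply/eqP.
  by apply: eq_integral => t _; rewrite glue_overwrite.
- exact: enum_val_inj.
- by apply/measurable_EFinP; exact: measurableT_comp.
Qed.

End envelope.

(** * Bound and integration by parts for the orthant primitive *)

Theorem theorem2p11 (R : realType) (d : nat) (hd : (0 < d)%N)
  (a b : 'rV[R]_d) (hab : forall i, a 0 i < b 0 i)
  (I : {set 'I_d}) (hI : I != finset.set0)
  (f : 'rV[R]_d -> R) (hf : Ck_upto_boundary #|I| (box a b) f)
  (phi : 'rV[R]_d -> R) (hphi : phi \in Lfun (lebesgue_box a b) +oo%E)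
  (hc : centered_on a b I phi) :
  let S := box a b in
  let U := upper_primitive b I phi in
  let dIf := pderiv_closure S (enum I) f in
  [/\ U \in Lfun (lebesgue_box a b) +oo%E,
      ('N[lebesgue_box a b]_+oo[EFin \o U]
        <= (2 ^- #|I|)%:E * mix_envelope a b I phi)%E,
      (\int[lebesgue_rV]_(x in S) (phi x * f x)%:E
        = \int[lebesgue_rV]_(x in S) (U x * dIf x)%:E)%E
    & (`| \int[lebesgue_rV]_(x in S) (phi x * f x)%:E |
        <= (2 ^- #|I|)%:E * mix_envelope a b I phi
           * \int[lebesgue_rV]_(x in S) `|dIf x|%:E)%E].
Proof.
move=> S U dIf.
have ab' i : a 0 i <= b 0 i by exact: ltW.
have mS : measurable S by exact: measurable_box.
have mphi := Lfun_box_measurable hphi.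
have [M M0 phiM] := Lfun_box_bounded hab hphi.
(* Truncation at an essential bound of [phi]. *)
pose psi x := if `|phi x| <= M then phi x else 0.
have mpsi : measurable_fun (setT : set 'rV[R]_d) psi.
  apply: measurable_fun_ifT => //; apply: measurable_fun_ler => //.
  exact: measurableT_comp.
have bpsi : bounded_in S psi.
  by exists M => // x _; rewrite /psi; case: ifP => // _; rewrite normr0.
have phipsi : \forall x \ae lebesgue_rV, S x -> phi x = psi x.
  by apply: filterS phiM => x H Sx; rewrite /psi H.
have psic : {in enum I, forall i, ae_centered a b i psi}.
  move=> i; rewrite mem_enum => iI.
  have c := centered_on_ae hc iI.
  have E := ae_eq_coord_integral hab i mphi mpsi phipsi.
  by apply: filterS2 c E => x cx Ex Sx; rewrite -Ex// cx.
pose Upsi := foldr (upper_primitive1 b) psi (enum I).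
have mU : measurable_fun (setT : set 'rV[R]_d) U by exact: measurable_iter_primitive.
have mUpsi : measurable_fun (setT : set 'rV[R]_d) Upsi by exact: measurable_iter_primitive.
have bUpsi : bounded_in S Upsi by exact: bounded_iter_primitive.
have UE : \forall x \ae lebesgue_rV, S x -> U x = Upsi x.
  exact: ae_eq_iter_primitive.
have LE : ('N[lebesgue_box a b]_+oo[EFin \o U]
        <= (2 ^- #|I|)%:E * mix_envelope a b I phi)%E.
  apply: Lnorm_box_le => //.
  have E1 := iter_primitive_le hab (enum_uniq _) mpsi bpsi psic.
  have E2 : \forall x \ae lebesgue_rV, S x ->
    (foldr (coord_eintegral a b) (fun y => `|psi y|%:E) (enum I) x <=
     foldr (coord_eintegral a b) (fun y => `|phi y|%:E) (enum I) x)%E.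
    apply: ae_le_iter_coord_eintegral => //.
    - by apply/measurable_EFinP; exact: measurableT_comp.
    - by apply/measurable_EFinP; exact: measurableT_comp.
    - by apply: filterS phipsi => x H Sx; rewrite H.
  have E3 : \forall x \ae lebesgue_rV, S x ->
    (foldr (coord_eintegral a b) (fun y => `|psi y|%:E) (enum I) x
      <= mix_envelope a b I phi)%E.
    apply: filterS2 E2 (iter_le_mix_envelope a b I mphi) => x E2 E3 Sx.
    exact: le_trans (E2 Sx) (E3 Sx).
  apply: filterS3 UE E1 E3 => x UE E1 E3 Sx.
  rewrite UE//; apply: le_trans (E1 Sx) _; rewrite -cardE.
  by rewrite lee_wpmul2l ?lee_fin ?invr_ge0 ?exprn_ge0// E3.
have [cf hCk] := hf.
(* From here on [G] and [F] extend the derivative and [f] to [R^d]. *)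
have [_ [g cg gE]] := hCk (enum I) ltac:(by rewrite -cardE).
have cG := continuous_comp_clamp ab' cg.
pose G := g \o clamp a b.
have mG : measurable_fun (setT : set 'rV[R]_d) G by exact: measurable_continuous_rV.
have bG : bounded_in S G.
  by apply: compact_bounded_in; [exact: compact_box|exact: continuous_subspaceT].
have dIfG x : S x -> dIf x = G x.
  by move=> Sx; rewrite /dIf (pderiv_closureE hab cg gE Sx) /G/= clamp_id.
pose F := f \o clamp a b.
have mF : measurable_fun (setT : set 'rV[R]_d) F.
  by apply: measurable_continuous_rV; exact: continuous_comp_clamp.
have bF : bounded_in S F.
  by apply: compact_bounded_in; [exact: compact_box|apply: continuous_subspaceT;
    exact: continuous_comp_clamp].
have FE x : S x -> f x = F x by move=> Sx; rewrite /F/= clamp_id.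
have IBP : (\int[lebesgue_rV]_(x in S) (phi x * f x)%:E
        = \int[lebesgue_rV]_(x in S) (U x * dIf x)%:E)%E.
  transitivity (\int[lebesgue_rV]_(x in S) (psi x * F x)%:E)%E.
    transitivity (\int[lebesgue_rV]_(x in S) (phi x * F x)%:E)%E.
      by apply: eq_integral => x; rewrite inE => Sx; rewrite FE.
    apply: ae_eq_integral => //.
    - by apply/measurable_EFinP; apply: measurable_funTS; exact: measurable_funM.
    - by apply/measurable_EFinP; apply: measurable_funTS; exact: measurable_funM.
    - by apply: filterS phipsi => x H Sx; rewrite H.
  transitivity (\int[lebesgue_rV]_(x in S) (Upsi x * G x)%:E)%E.
    rewrite -!EFin_Rintegral//; try exact: lebesgue_box_lty;
      try exact: bounded_inM; try by apply: measurable_funTS; exact: measurable_funM.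
    congr EFin; apply: (iter_by_parts hab hf) => //.
    - by rewrite -cardE.
    - exact: enum_uniq.
    - by move=> y Sy; rewrite /G/= clamp_id ?gE//; exact: interior_subset Sy.
  transitivity (\int[lebesgue_rV]_(x in S) (U x * G x)%:E)%E.
    apply: ae_eq_integral => //.
    - by apply/measurable_EFinP; apply: measurable_funTS; exact: measurable_funM.
    - by apply/measurable_EFinP; apply: measurable_funTS; exact: measurable_funM.
    - by apply: filterS UE => x H Sx; rewrite H.
  by apply: eq_integral => x; rewrite inE => Sx; rewrite dIfG.
split => //.
- rewrite inE; apply/andP; split; rewrite inE//=.
  have [K K0 UK] := bUpsi.
  rewrite /finite_norm (@le_lt_trans _ _ K%:E) ?ltry//.
  apply: Lnorm_box_le => //; apply: filterS UE => x H Sx.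
  by rewrite lee_fin H// UK.
- rewrite IBP.
  (* The envelope bound is nonnegative, since it dominates a norm. *)
  have K0 := le_trans (Lnorm_ge0 _ _ _) LE.
  pose K := ((2 ^- #|I|)%:E * mix_envelope a b I phi)%E.
  have -> : (\int[lebesgue_rV]_(x in S) (U x * dIf x)%:E =
     \int[lebesgue_rV]_(x in S) (U x * G x)%:E)%E.
    by apply: eq_integral => x; rewrite inE => Sx; rewrite dIfG.
  have -> : (\int[lebesgue_rV]_(x in S) `|dIf x|%:E =
     \int[lebesgue_rV]_(x in S) `|G x|%:E)%E.
    by apply: eq_integral => x; rewrite inE => Sx; rewrite dIfG.
  have mUG : measurable_fun S (fun x => (U x * G x)%:E).
    by apply/measurable_EFinP; apply: measurable_funTS; exact: measurable_funM.
  have maG : measurable_fun S (fun x => `|G x|%:E).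
    by apply/measurable_EFinP; apply: measurable_funTS; exact: measurableT_comp.
  apply: le_trans (le_abse_integral _ mS mUG) _.
  rewrite -ge0_integralZl//.
  apply: ae_ge0_le_integral => //.
  + exact: measurableT_comp.
  + by move=> x _; rewrite mule_ge0.
  + by apply: emeasurable_funM => //; exact: measurable_cst.
  have UK : \forall x \ae lebesgue_rV, S x -> (`|U x|%:E <= K)%E.
    move: LE; rewrite Lnorm.unlock lebesgue_box_gt0// => /ess_supP.
    exact: (ae_lebesgue_box a b _).1.
  by apply: filterS UK => x H Sx; rewrite abse_EFin normrM EFinM lee_wpmul2r ?lee_fin// H.
Qed.
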